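(* Let $\{X_t:t\ge0\}$ be a $d$-dimensional Lévy process and let $b:[0,1]\to[0,1]$ be continuous and increasing with $b(1)=1$, $b(t)/t\to\infty$ as $t\to0$, such that on some interval $[0,t_0]$: (i) $b(t)/t^\rho$ is non-decreasing for some $\rho>1/3$; (ii) for every $\varepsilon>0$ there is $0<\delta_\varepsilon<t_0$ with $b(s)/b(t)\ge(1-\varepsilon)s/t$ for $0\le s\le t\le\delta_\varepsilon$. Assume that for every $\delta>0$ there exist $K_\delta>0$ and $0<t_\delta<1$ with $\mathbb{P}\{|X_t|>K_\delta b(t)\}<\delta$ for $0<t<t_\delta$. Given $x\in\mathbb{R}^d$, the following are equivalent: (a) with probability one, $x\in C(\{X_t/b(t):t\downarrow0\})$; (b) $\int_0^1t^{-1}\mathbb{P}\{|X_t/b(t)-x|<\varepsilon\}\,dt=\infty$ for all $\varepsilon>0$.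
   Context: $|\cdot|$ is the Euclidean norm. The cluster set $C(\{X_t/b(t):t\downarrow0\})$ is the (random) set of all limit points of $X_{t_n}/b(t_n)$ along sequences $t_n\downarrow0$. *)

(* Defs.v *)
From HB Require Import structures.
From mathcomp Require Import all_boot all_order all_algebra.
From mathcomp Require Import all_classical all_reals all_analysis.
Set Implicit Arguments. Unset Strict Implicit. Unset Printing Implicit Defensive.
Import Order.TTheory GRing.Theory Num.Theory.
Import numFieldNormedType.Exports.
Local Open Scope classical_set_scope.
Local Open Scope ring_scope.

Section Defs.
Variables (R : realType) (d : nat).

Definition eucl_norm (v : 'rV[R]_d) : R :=
  Num.sqrt (\sum_(i < d) (v ord0 i) ^+ 2).

Definition eucl_open (U : set 'rV[R]_d) : Prop :=
  forall y, U y -> exists2 r : R, 0 < r &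
    forall z, eucl_norm (z - y) < r -> U z.

Definition borel_Rd (B : set 'rV[R]_d) : Prop := <<s eucl_open >> B.

Definition cluster_set (f : R -> 'rV[R]_d) : set 'rV[R]_d :=
  [set y | exists u : nat -> R,
     [/\ (forall n, 0 < u n), u @ \oo --> (0 : R) &
         (fun n => eucl_norm (f (u n) - y)) @ \oo --> (0 : R)]].

End Defs.

Definition levy_process (dT : measure_display) (T : measurableType dT)
    (R : realType) (P : probability T R) (d : nat) (X : R -> T -> 'rV[R]_d) : Prop :=
  [/\
      (forall t (i : 'I_d), 0 <= t -> measurable_fun setT (fun w => X t w ord0 i)),
      {ae P, forall w, X 0 w = 0 /\
          (forall t, 0 <= t ->
             (fun s => eucl_norm (X s w - X t w)) @ t^'+ --> (0 : R)) /\
          (forall t, 0 < t -> exists l : 'rV[R]_d,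
             (fun s => eucl_norm (X s w - l)) @ t^'- --> (0 : R))},
      (forall (n : nat) (u : nat -> R) (B : nat -> set 'rV[R]_d),
         0 <= u 0%N -> (forall k, (k < n)%N -> u k < u k.+1) ->
         (forall k, (k < n)%N -> borel_Rd (B k)) ->
         P (\bigcap_(k < n) [set w | B k (X (u k.+1) w - X (u k) w)]) =
         (\prod_(k < n) P [set w | B k (X (u k.+1) w - X (u k) w)%R])%E),
      (forall s t (B : set 'rV[R]_d), 0 <= s -> s <= t -> borel_Rd B ->
         P [set w | B (X t w - X s w)] = P [set w | B (X (t - s) w)]) &
      (forall t e eta : R, 0 <= t -> 0 < e -> 0 < eta -> exists2 r : R, 0 < r &
         forall s, 0 <= s -> `|s - t| < r ->
           (P [set w | (e < eucl_norm (X s w - X t w))%R] < eta%:E)%E)].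

(* Main.v *)
Require Import Defs.
From HB Require Import structures.
From mathcomp Require Import all_boot all_order all_algebra.
From mathcomp Require Import all_classical all_reals all_analysis.
From mathcomp Require Import measurable_realfun ring lra.
Import Order.TTheory GRing.Theory Num.Theory.
Import numFieldNormedType.Exports.
Local Open Scope classical_set_scope.
Local Open Scope ring_scope.

(* Both directions compare P{|X_t / b(t) - x| < e} with the probability of
   hitting such a neighbourhood around time t; when v / u is close to 1, the
   increment over [u, v] and b(v) - b(u) are both negligible against b(v).

   (a) => (b). An Ottaviani-type first-passage inequality shows that, for v in
   a geometric block of times, the probability of a visit near x (at scale e)
   during the next smaller block is at most twice the probability of being near
   x at time v (at scale 5e). If the integral converged, these visit
   probabilities would be summable and Borel-Cantelli would exclude x.

   (b) => (a). If x fails to be a cluster point with positive probability, then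
   for some e the event N "no visit e-near x before some time" has
   probability p > 0. Write X_v, for v slightly larger than t, as X_(v-t) plus
   an independent copy of X_t: if X_t is near b(t) x, X_(v-t) is small and N
   holds, then v is a first visit along a geometric sequence t_k of times, up to
   finitely many indices. Hence (p / 2) P{X_t near b(t) x} is at most
   a_k - a_(k+r), where a_k is the probability of a visit among the t_j with
   j >= k; these differences telescope, so the integral converges. No zero-one
   law is needed. *)

(** * The Euclidean norm *)

Section EuclideanNorm.
Variables (R : realType) (d : nat).
Implicit Types u v : 'rV[R]_d.

Lemma eucl_norm_ge0 v : 0 <= eucl_norm v.
Proof. exact: sqrtr_ge0. Qed.

Lemma sqr_eucl_norm v : eucl_norm v ^+ 2 = \sum_(i < d) v ord0 i ^+ 2.
Proof. by rewrite sqr_sqrtr// sumr_ge0// => i _; exact: sqr_ge0. Qed.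

Lemma eucl_normZ (a : R) v : eucl_norm (a *: v) = `|a| * eucl_norm v.
Proof.
rewrite /eucl_norm -sqrtr_sqr -sqrtrM ?sqr_ge0// mulr_sumr.
by congr Num.sqrt; apply: eq_bigr => i _; rewrite mxE exprMn.
Qed.

Lemma eucl_normN v : eucl_norm (- v) = eucl_norm v.
Proof. by rewrite -scaleN1r eucl_normZ normrN1 mul1r. Qed.

Lemma eucl_distC u v : eucl_norm (u - v) = eucl_norm (v - u).
Proof. by rewrite -eucl_normN opprB. Qed.

Lemma ler_coord_eucl_norm v i : `|v ord0 i| <= eucl_norm v.
Proof.
rewrite -sqrtr_sqr ler_sqrt ?sqr_ge0//; last first.
  by rewrite sumr_ge0// => j _; exact: sqr_ge0.
by rewrite (bigD1 i)//= lerDl sumr_ge0// => j _; exact: sqr_ge0.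
Qed.

(** Cauchy-Schwarz: expanding the nonnegative sum of [(c * u_i - a * v_i) ^+ 2], with [a] and [c]
    the norms, gives the bound multiplied by [2 * (a * c)]. When [a * c] vanishes, one vector is
    zero and both sides are treated directly. *)
Lemma eucl_dot_le u v :
  \sum_(i < d) u ord0 i * v ord0 i <= eucl_norm u * eucl_norm v.
Proof.
set a := eucl_norm u; set c := eucl_norm v.
have a0 : 0 <= a by exact: eucl_norm_ge0.
have c0 : 0 <= c by exact: eucl_norm_ge0.
have key : 2 * (a * c) * (\sum_(i < d) u ord0 i * v ord0 i) <=
    2 * (a * c) * (a * c).
  have : 0 <= \sum_(i < d) (c * u ord0 i - a * v ord0 i) ^+ 2.
    by apply: sumr_ge0 => i _; exact: sqr_ge0.
  have -> : \sum_(i < d) (c * u ord0 i - a * v ord0 i) ^+ 2 =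
      \sum_(i < d) (c ^+ 2 * (u ord0 i) ^+ 2 + a ^+ 2 * (v ord0 i) ^+ 2
         + (- (2 * (a * c)) * (u ord0 i * v ord0 i))).
    by apply: eq_bigr => i _; ring.
  rewrite !big_split/= -!mulr_sumr -!sqr_eucl_norm -/a -/c.
  by move=> ?; lra.
have zero (w : 'rV[R]_d) : eucl_norm w = 0 -> forall i, w ord0 i = 0.
  move=> w0 i; apply/eqP; rewrite -normr_eq0 eq_le normr_ge0 andbT.
  by rewrite -w0 ler_coord_eucl_norm.
have [ac0|] := ltP 0 (a * c).
  by rewrite ler_pM2l// in key; rewrite mulr_gt0.
move=> ac; have : a * c == 0 by rewrite eq_le ac mulr_ge0.
rewrite mulf_eq0 => /orP[] /eqP /zero z; rewrite big1 ?mulr_ge0// => i _;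
  by rewrite z ?mul0r ?mulr0.
Qed.

Lemma ler_eucl_normD u v : eucl_norm (u + v) <= eucl_norm u + eucl_norm v.
Proof.
rewrite -(ler_pXn2r (ltn0Sn 1)) ?nnegrE ?addr_ge0 ?eucl_norm_ge0//.
rewrite sqr_eucl_norm; under eq_bigr do rewrite mxE sqrrD.
rewrite !big_split/= -!sqr_eucl_norm.
by have := eucl_dot_le u v; lra.
Qed.

Lemma eucl_open_ball (y : 'rV[R]_d) (r : R) :
  eucl_open [set z | eucl_norm (z - y) < r].
Proof.
move=> z /= zr; exists (r - eucl_norm (z - y)); first by rewrite subr_gt0.
move=> t tz; have -> : t - y = (t - z) + (z - y) by rewrite addrA subrK.
by rewrite (le_lt_trans (ler_eucl_normD _ _))// -ltrBrDr.
Qed.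

Lemma borel_Rd_ball (y : 'rV[R]_d) (r : R) :
  borel_Rd [set z | eucl_norm (z - y) < r].
Proof. by apply: sub_sigma_algebra; exact: eucl_open_ball. Qed.

Lemma borel_Rd_norm_gt (c : R) : borel_Rd [set z : 'rV[R]_d | c < eucl_norm z].
Proof.
apply: sub_sigma_algebra => y /= cy; exists (eucl_norm y - c).
  by rewrite subr_gt0.
move=> z; have := ler_eucl_normD z (y - z).
by rewrite addrCA subrr addr0 eucl_distC; lra.
Qed.

Lemma borel_Rd_coord_gt (i : 'I_d) (a : R) :
  borel_Rd [set z : 'rV[R]_d | a < z ord0 i].
Proof.
apply: sub_sigma_algebra => z /= az; exists (z ord0 i - a).
  by rewrite subr_gt0.
move=> t /(le_lt_trans (ler_coord_eucl_norm _ i)); rewrite !mxE.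
by rewrite ltr_norml => /andP[? _]; lra.
Qed.

Lemma borel_RdT : borel_Rd (setT : set 'rV[R]_d).
Proof.
exact: (@measurableT _ (g_sigma_algebraType (@eucl_open R d))).
Qed.

Lemma borel_RdI (A B : set 'rV[R]_d) :
  borel_Rd A -> borel_Rd B -> borel_Rd (A `&` B).
Proof.
exact: (@measurableI _ (g_sigma_algebraType (@eucl_open R d))).
Qed.

Lemma measurable_eucl_norm {dS : measure_display} (S : measurableType dS)
    (D : set S) (Z : S -> 'rV[R]_d) :
  (forall i, measurable_fun D (fun w => Z w ord0 i)) ->
  measurable_fun D (fun w => eucl_norm (Z w)).
Proof.
move=> mZ.
rewrite (_ : (fun w => _) =
    (@Num.sqrt R) \o (fun w => \sum_(i < d) Z w ord0 i ^+ 2))//.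
apply: measurableT_comp.
  by apply: continuous_measurable_fun; exact: sqrt_continuous.
by apply: measurable_sum => i; apply: measurable_funX.
Qed.

End EuclideanNorm.

(** * Independence of the past and the Ottaviani inequality *)

(* [X_t - X_0]: [levy_process] gives [X_0 = 0] only almost surely. *)
Definition centered_levy {dT : measure_display} {T : measurableType dT}
    {R : realType} (P : probability T R) (d : nat) (Y : R -> T -> 'rV[R]_d) :=
  [/\ forall t (i : 'I_d), 0 <= t -> measurable_fun setT (fun w => Y t w ord0 i),
      forall w, Y 0 w = 0,
      forall (n : nat) (u : nat -> R) (B : nat -> set 'rV[R]_d),
        0 <= u 0%N -> (forall k, (k < n)%N -> u k < u k.+1) ->
        (forall k, (k < n)%N -> borel_Rd (B k)) ->
        P (\bigcap_(k < n) [set w | B k (Y (u k.+1) w - Y (u k) w)]) =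
        (\prod_(k < n) P [set w | B k (Y (u k.+1) w - Y (u k) w)%R])%E &
      forall s t (B : set 'rV[R]_d), 0 <= s -> s <= t -> borel_Rd B ->
        P [set w | B (Y t w - Y s w)] = P [set w | B (Y (t - s) w)]].

(** Subtracting [X 0] leaves every increment unchanged, and the increment over [[0, t - s]] has the
    law of [X (t - s)] by stationarity from time 0. *)
Lemma centered_levy_of_levy {dT : measure_display} {T : measurableType dT}
    {R : realType} (P : probability T R) (d : nat) (X : R -> T -> 'rV[R]_d) :
  levy_process P X -> centered_levy P d (fun t w => X t w - X 0 w).
Proof.
case=> mX _ indX stX _.
have YX s t w : (X t w - X 0 w) - (X s w - X 0 w) = X t w - X s w.
  by rewrite opprB addrA subrK.
split.
- move=> t i t0; rewrite (_ : (fun w => _) = (fun w => X t w ord0 i - X 0 w ord0 i)).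
    by apply: measurable_funB; exact: mX.
  by apply/funext => w; rewrite !mxE.
- by move=> w; rewrite subrr.
- move=> n u B u0 ui bB.
  have E k : [set w | B k (X (u k.+1) w - X 0 w - (X (u k) w - X 0 w))] =
      [set w | B k (X (u k.+1) w - X (u k) w)].
    by apply/seteqP; split => w /=; rewrite YX.
  under eq_bigcapr do rewrite E.
  by rewrite indX//; apply: eq_bigr => k _; rewrite E.
- move=> s t B s0 st bB.
  rewrite (_ : [set w | _] = [set w | B (X t w - X s w)]); last first.
    by apply/seteqP; split => w /=; rewrite YX.
  by rewrite stX// (stX 0 (t - s))// ?subr_ge0// subr0.
Qed.

(** Puts finitely many past times, in any order and with repetitions, into the form that the
    independence of increments expects: a strictly increasing grid from 0 whose last step is the
    increment from [s] to [t]. *)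
Lemma exists_increasing_grid {R : realType} (l : seq R) (s t : R) :
  0 <= s -> s < t -> (forall r, r \in l -> 0 <= r <= s) ->
  exists n u, [/\ u 0%N = 0, u n = s, u n.+1 = t,
    (forall k, (k <= n)%N -> u k < u k.+1) &
    forall r, r \in l -> exists2 k, (k <= n)%N & u k = r].
Proof.
move=> s0 st l0s.
pose g := sort <=%R (undup (0 :: s :: l)).
have gsorted : sorted <%R g by rewrite sort_lt_sorted undup_uniq.
have gE r : (r \in g) = (r \in 0 :: s :: l) by rewrite mem_sort mem_undup.
have g0s r : r \in g -> 0 <= r <= s.
  rewrite gE !inE => /or3P[/eqP->|/eqP->|/l0s//]; first by rewrite lexx.
  by rewrite s0 lexx.
have gsz : (0 < size g)%N.
  rewrite lt0n size_eq0; apply/eqP => g0.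
  by have := gE 0; rewrite g0 in_nil mem_head.
have glt i j : (i < j)%N -> (j < size g)%N -> nth t g i < nth t g j.
  move=> ij jg; apply: (sorted_ltn_nth lt_trans) => //; rewrite inE//.
  exact: ltn_trans jg.
have gle i j : (i <= j)%N -> (j < size g)%N -> nth t g i <= nth t g j.
  by rewrite leq_eqVlt => /predU1P[-> //|ij jg]; exact/ltW/glt.
have predlt : ((size g).-1 < size g)%N by rewrite prednK.
have gidx r : r \in g -> exists2 k, (k < size g)%N & nth t g k = r.
  by move=> rg; exists (index r g); rewrite ?index_mem// nth_index.
(* The default value [t] of [nth] supplies the grid point just beyond the end of [g]. *)
exists (size g).-1, (nth t g); split.
- have g0 : 0 \in g by rewrite gE mem_head.
  have [k kg k0] := gidx 0 g0.
  apply/eqP; rewrite eq_le -{1}k0 gle//=.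
  by have /andP[] := g0s _ (mem_nth t gsz).
- have sg : s \in g by rewrite gE !inE eqxx orbT.
  have [k kg ks] := gidx s sg.
  have k1 : (k <= (size g).-1)%N by rewrite -ltnS prednK.
  have sle : s <= nth t g (size g).-1 by rewrite -ks; exact: gle.
  apply/eqP; rewrite eq_le sle andbT.
  by have /andP[] := g0s _ (mem_nth t predlt).
- by rewrite prednK// nth_default.
- move=> k; rewrite leq_eqVlt => /predU1P[->|kg].
    rewrite prednK// [ltRHS]nth_default// (le_lt_trans _ st)//.
    by have /andP[] := g0s _ (mem_nth t predlt).
  by apply: glt => //; rewrite -ltn_predRL.
- move=> r rl; have [k kg kr] : exists2 k, (k < size g)%N & nth t g k = r.
    by apply: gidx; rewrite gE !inE rl !orbT.
  by exists k => //; rewrite -ltnS prednK.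
Qed.

(** * Independence of an increment from finitely many earlier values *)

Section PastIndependence.
Context {dT : measure_display} {T : measurableType dT} {R : realType}.
Variables (P : probability T R) (d : nat) (Y : R -> T -> 'rV[R]_d).
Hypothesis LY : centered_levy P d Y.

(** Half-line events of the coordinates; [<<s past l >>] is the sigma-algebra generated by the
    values of [Y] at the times in [l]. *)
Definition past (l : seq R) : set (set T) :=
  [set A | exists t (i : 'I_d) a, t \in l /\ A = [set w | a < Y t w ord0 i]].

(** A pi-system for the first [n] increments along [u]. Measurability of each factor is part of the
    definition, so the members are events by construction. *)
Definition incr_cylinders (u : nat -> R) (n : nat) : set (set T) :=
  [set A | exists B : nat -> set 'rV[R]_d,
     (forall k, (k < n)%N -> borel_Rd (B k) /\
        measurable [set w | B k (Y (u k.+1) w - Y (u k) w)]) /\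
     A = \bigcap_(k < n) [set w | B k (Y (u k.+1) w - Y (u k) w)]].

Lemma incr_cylinders_measurable u n : incr_cylinders u n `<=` measurable.
Proof.
move=> _ [B [mB ->]]; rewrite bigcap_mkord.
by apply: bigsetI_measurable => -[k kn] _ /=; have [] := mB k kn.
Qed.

Lemma incr_cylindersI u n : setI_closed (incr_cylinders u n).
Proof.
move=> _ _ [B [mB ->]] [C [mC ->]]; exists (fun k => B k `&` C k); split.
  move=> k kn; have [bB ?] := mB k kn; have [bC ?] := mC k kn.
  by split; [exact: borel_RdI|exact: measurableI].
by rewrite -bigcapI.
Qed.

Lemma measurable_coord_incr u n k (i : 'I_d) : (k < n)%N ->
    (forall j, (j <= n)%N -> 0 <= u j) ->
  measurable_fun (setT : set (g_sigma_algebraType (incr_cylinders u n)))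
    (fun w => (Y (u k.+1) w - Y (u k) w) ord0 i).
Proof.
have [mY _ _ _] := LY; move=> kn u0; apply: (measurability _ (RGenOInfty.measurableE R)).
move=> _ [_ [a ->] <-]; rewrite setTI; apply: sub_sigma_algebra.
(* The cylinder that constrains the [k]-th increment alone. *)
exists (fun j => if j == k then [set z | a < z ord0 i] else setT); split.
  move=> j jn; case: eqP => [->|_]; last by split; [exact: borel_RdT|exact: measurableT].
  split; first exact: borel_Rd_coord_gt.
  rewrite [X in measurable X](_ : _ = (fun w => Y (u k.+1) w ord0 i -
      Y (u k) w ord0 i) @^-1` `]a, +oo[); last first.
    by apply/seteqP; split=> w /=; rewrite !mxE in_itv/= andbT.
  rewrite -[X in measurable X]setTI; apply: measurable_funB => //.
  - by apply: mY; exact: u0.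
  - by apply: mY; apply: u0; exact: ltnW.
apply/seteqP; split=> w /=.
  rewrite in_itv/= andbT => aw j jn /=; case: eqP => // ->//.
move=> /(_ k kn) /=; rewrite eqxx /= in_itv/= andbT; exact.
Qed.

Lemma measurable_coord_grid u n k (i : 'I_d) : (k <= n)%N -> u 0%N = 0 ->
    (forall j, (j <= n)%N -> 0 <= u j) ->
  measurable_fun (setT : set (g_sigma_algebraType (incr_cylinders u n)))
    (fun w => Y (u k) w ord0 i).
Proof.
have [_ Y0 _ _] := LY; move=> kn u00 u0; elim: k kn => [_|k IH kn].
  rewrite u00 (_ : (fun w => _) = cst 0)//.
  by apply/funext => w; rewrite Y0 mxE.
rewrite (_ : (fun w => _) = (fun w => Y (u k) w ord0 i +
    (Y (u k.+1) w - Y (u k) w) ord0 i)); last first.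
  by apply/funext => w; rewrite !mxE addrCA subrr addr0.
apply: measurable_funD; first exact: (IH (ltnW kn)).
exact: measurable_coord_incr.
Qed.

(** For the fixed last event [F], both [P (E]&[F)] and [P E * P F] are finite measures in [E].
    Independence of increments makes them agree on the pi-system of cylinders, hence on the
    sigma-algebra it generates. *)
Lemma indep_incr_cylinders u n B E :
  0 <= u 0%N -> (forall k, (k <= n)%N -> u k < u k.+1) -> borel_Rd B ->
  measurable [set w | B (Y (u n.+1) w - Y (u n) w)] ->
  <<s incr_cylinders u n >> E ->
  P (E `&` [set w | B (Y (u n.+1) w - Y (u n) w)]) =
  (P E * P [set w | B (Y (u n.+1) w - Y (u n) w)%R])%E.
Proof.
have [_ _ indepY _] := LY; move=> u0 ui bB mF; set F := [set w | _].
have PF0 : 0 <= fine (P F) by rewrite fine_ge0.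
pose m1 : {measure set T -> \bar R} := mrestr P mF.
pose m2 : {measure set T -> \bar R} := mscale (NngNum PF0) P.
have m1E A : m1 A = P (A `&` F) by [].
have m2E A : m2 A = (P A * P F)%E.
  by rewrite muleC -[P F]fineK ?fin_num_measure.
move=> sE; rewrite -m1E -m2E.
have cT : incr_cylinders u n setT.
  exists (fun=> setT); split.
    by move=> k _; split; [exact: borel_RdT|exact: measurableT].
  by apply/esym; rewrite -subTset => w _ k _.
apply: (g_sigma_algebra_measure_unique (incr_cylinders u n) _ (fun=> setT)) => //.
- exact: incr_cylinders_measurable.
- by rewrite bigcup_const.
- exact: incr_cylindersI.
- move=> _ [C [mC ->]]; rewrite m1E m2E indepY//; last 2 first.
  + by move=> k kn; exact/ui/ltnW.
  + by move=> k /mC[].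
  (* A cylinder over [n] increments intersected with [F] is a cylinder over [n.+1] increments with
     [B] as its last factor. *)
  pose C' k := if k == n then B else C k.
  have := indepY n.+1 u C' u0 (fun k kn => ui k kn).
  have bC' k : (k < n.+1)%N -> borel_Rd (C' k).
    rewrite ltnS leq_eqVlt /C'; case: eqP => //= _ /mC[]//.
  move=> /(_ bC'); rewrite big_ord_recr/= [in P [set w | C' n _]]/C' eqxx.
  rewrite (eq_bigr (fun k : 'I_n =>
      P [set w | C k (Y (u k.+1) w - Y (u k) w)%R])); last first.
    by move=> [k kn] _; rewrite /C' /= ltn_eqF.
  move=> <-; congr (P _); apply/seteqP; split => w /=.
    move=> [Cw Fw] k /=; rewrite ltnS leq_eqVlt /C'; case: eqP => [->//|_/=].
    exact: Cw.
  move=> Cw; split=> [k /= kn|].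
    by have := Cw k (ltnW kn); rewrite /C' ltn_eqF.
  by have := Cw n (leqnn _); rewrite /C' eqxx.
- move=> _; rewrite m1E setTI.
  by rewrite ltey_eq fin_num_measure.
Qed.

(** All times of [l] lie on one grid, where each value is a sum of increments because [Y 0 = 0]; so
    the past is contained in the sigma-algebra of the increments before [s]. Stationarity then
    replaces the last increment by [Y (t - s)]. *)
Lemma indep_past (l : seq R) (s t : R) (B : set 'rV[R]_d) (E : set T) :
  0 <= s -> s < t -> (forall r, r \in l -> 0 <= r <= s) -> borel_Rd B ->
  measurable [set w | B (Y t w - Y s w)] -> <<s past l >> E ->
  P (E `&` [set w | B (Y t w - Y s w)]) = (P E * P [set w | B (Y (t - s) w)])%E.
Proof.
have [_ _ _ statY] := LY; move=> s0 st l0s bB mF sE.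
have [n [u [u0 un un1 ui ul]]] := exists_increasing_grid l s t s0 st l0s.
have uge0 j : (j <= n.+1)%N -> 0 <= u j.
  elim: j => [|j IH] jn; first by rewrite u0.
  by rewrite (le_trans (IH (ltnW jn)))// ltW// ui.
rewrite -un -un1 in mF *.
have ustep k : (k <= n)%N -> u k < u k.+1 by exact: ui.
rewrite (indep_incr_cylinders u n B E) ?u0//.
  by rewrite statY// ?uge0// ltW// ui.
apply: (smallest_sub _ _ sE).
  exact: (@sigma_algebra_measurable _ (g_sigma_algebraType (incr_cylinders u n))).
move=> _ [r [i [a [rl ->]]]]; have [k kn <-] := ul r rl.
have /(_ measurableT `]a, +oo[%classic)
  := measurable_coord_grid u n k i kn u0 (fun j jn => uge0 j (leqW jn)).
rewrite setTI; move=> /(_ (measurable_itv _)).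
rewrite (_ : _ @^-1` _ = [set w | a < Y (u k) w ord0 i])//.
by apply/seteqP; split => w /=; rewrite in_itv/= andbT.
Qed.

Lemma past_ball (l : seq R) (t : R) (y : 'rV[R]_d) (c : R) : t \in l ->
  <<s past l >> [set w | eucl_norm (Y t w - y) < c].
Proof.
move=> tl; pose S := g_sigma_algebraType (past l).
have mYt (i : 'I_d) : measurable_fun (setT : set S) (fun w => Y t w ord0 i).
  apply: (measurability _ (RGenOInfty.measurableE R)).
  move=> _ [_ [a ->] <-]; rewrite setTI; apply: sub_sigma_algebra.
  exists t, i, a; split => //.
  by apply/seteqP; split => w /=; rewrite in_itv/= andbT.
have mN : measurable_fun (setT : set S) (fun w => eucl_norm (Y t w - y)).
  apply: measurable_eucl_norm => i.
  rewrite (_ : (fun w => _) = (fun w => Y t w ord0 i - y ord0 i)); last first.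
    by apply/funext => w; rewrite !mxE.
  by apply: measurable_funB.
have := mN measurableT `]-oo, c[%classic (measurable_itv _); rewrite setTI.
by congr (<<s _ >> _); apply/seteqP; split => w /=; rewrite in_itv.
Qed.

Lemma past_measurable (l : seq R) : (forall r, r \in l -> 0 <= r) ->
  <<s past l >> `<=` @measurable _ T.
Proof.
have [mY _ _ _] := LY; move=> l0; apply: smallest_sub.
  exact: sigma_algebra_measurable.
move=> _ [r [i [a [rl ->]]]]; rewrite -[X in measurable X]setTI.
rewrite (_ : [set w | _] = (fun w => Y r w ord0 i) @^-1` `]a, +oo[).
  by apply: mY => //; exact: l0.
by apply/seteqP; split => w /=; rewrite in_itv/= andbT.
Qed.

Lemma measurable_ball (t : R) (y : 'rV[R]_d) (c : R) : 0 <= t ->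
  measurable [set w | eucl_norm (Y t w - y) < c].
Proof.
move=> t0; apply: (@past_measurable [:: t]); last by apply: past_ball; exact: mem_head.
by move=> r; rewrite inE => /eqP ->.
Qed.

Lemma measurable_ball_incr (s t : R) (y : 'rV[R]_d) (c : R) : 0 <= s -> 0 <= t ->
  measurable [set w | eucl_norm (Y t w - Y s w - y) < c].
Proof.
have [mY _ _ _] := LY; move=> s0 t0.
have mN : measurable_fun setT (fun w => eucl_norm (Y t w - Y s w - y)).
  apply: measurable_eucl_norm => i.
  rewrite (_ : (fun w => _) = (fun w => Y t w ord0 i - Y s w ord0 i - y ord0 i)).
    by apply: measurable_funB => //; apply: measurable_funB; exact: mY.
  by apply/funext => w; rewrite !mxE.
have := mN measurableT `]-oo, c[%classic (measurable_itv _); rewrite setTI.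
by congr measurable; apply/seteqP; split => w /=; rewrite in_itv.
Qed.

Lemma indep_past_ball (l : seq R) (s t : R) (y : 'rV[R]_d) (c : R) (E : set T) :
  0 <= s -> s < t -> (forall r, r \in l -> 0 <= r <= s) -> <<s past l >> E ->
  P (E `&` [set w | eucl_norm (Y t w - Y s w - y) < c]) =
  (P E * P [set w | (eucl_norm (Y (t - s) w - y) < c)%R])%E.
Proof.
move=> s0 st l0s sE.
have := indep_past l s t _ E s0 st l0s
  (borel_Rd_ball R d y c) (measurable_ball_incr s t y c s0 _) sE.
by apply; rewrite (le_trans s0)// ltW.
Qed.

(** First-passage decomposition by induction on the sorted times. A visit at the first time [q],
    together with [E], belongs to the past of [q] and is independent of the increment from [q] to
    [v], which is small with probability at least [kappa]. The remaining visits are handled with [E]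
    replaced by [E]\[H] and [q] added to the past; the two parts are disjoint, so the bounds add
    up. *)
Lemma ottaviani_past (l0 l : seq R) (v g kappa : R) (h : R -> 'rV[R]_d) (c : R -> R)
    (E : set T) :
  0 <= kappa -> sorted <=%R l ->
  (forall q, q \in l -> 0 < q < v) -> (forall r, r \in l0 -> 0 <= r) ->
  (forall r q, r \in l0 -> q \in l -> r <= q) ->
  (forall q, q \in l -> kappa%:E <= P [set w | (eucl_norm (Y (v - q) w) < g)%R])%E ->
  <<s past l0 >> E ->
  (kappa%:E * P (E `&` \big[setU/set0]_(q <- l)
      [set w | (eucl_norm (Y q w - h q) < c q)%R]) <=
   P (E `&` \big[setU/set0]_(q <- l)
      ([set w | (eucl_norm (Y q w - h q) < c q)%R] `&`
       [set w | (eucl_norm (Y v w - Y q w) < g)%R])))%E.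
Proof.
move=> k0; elim: l l0 E => [|q l IH] l0 E sl lv l00 l0l lk sE.
  by rewrite !big_nil !setI0 measure0 mule0.
rewrite !big_cons; set H := [set w | _ < c q]; set G := [set w | _ < g].
set U := \big[setU/set0]_(q <- l) _; set V := \big[setU/set0]_(q <- l) _.
have /andP[q0 qv] : 0 < q < v by apply: lv; exact: mem_head.
have GE : G = [set w | eucl_norm (Y v w - Y q w - 0) < g].
  by apply/seteqP; split => w /=; rewrite subr0.
pose l0' := q :: l0.
have l0'0 r : r \in l0' -> 0 <= r.
  by rewrite inE => /predU1P[->|/l00//]; exact: ltW.
have sH : <<s past l0' >> H by apply: past_ball; exact: mem_head.
have sE' : <<s past l0' >> E.
  apply: (smallest_sub _ _ sE).
    exact: (@sigma_algebra_measurable _ (g_sigma_algebraType (past l0'))).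
  move=> _ [r [i [a [rl ->]]]]; apply: sub_sigma_algebra; exists r, i, a.
  by split => //; rewrite inE rl orbT.
pose S := g_sigma_algebraType (past l0').
have sEH : <<s past l0' >> (E `&` H) by exact: (@measurableI _ S).
have sEH' : <<s past l0' >> (E `\` H) by exact: (@measurableD _ S).
have mE := past_measurable l0' l0'0 _ sE'.
have mH := past_measurable l0' l0'0 _ sH.
have v0 : 0 <= v by rewrite ltW// (lt_trans q0).
have ql r : r \in l -> q <= r.
  by move=> rl; move: sl => /= /(order_path_min le_trans)/allP; exact.
have mG r : 0 <= r -> measurable [set w | eucl_norm (Y v w - Y r w) < g].
  move=> r0; have := measurable_ball_incr r v 0 g r0 v0.
  by congr measurable; apply/seteqP; split => w /=; rewrite subr0.
have mU : measurable U.
  rewrite /U big_seq; apply: bigsetU_measurable => r rl.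
  apply: measurable_ball.
  by have /andP[/ltW] := lv r (mem_behead (rl : r \in behead (q :: l))).
have mV : measurable V.
  rewrite /V big_seq; apply: bigsetU_measurable => r rl.
  have /andP[/ltW r0 _] := lv r (mem_behead (rl : r \in behead (q :: l))).
  by apply: measurableI; [exact: measurable_ball|exact: mG].
have mGq := mG q (ltW q0).
have -> : E `&` (H `|` U) = (E `&` H) `|` ((E `\` H) `&` U).
  apply/seteqP; split => w /=; last by tauto.
  by move=> [Ew HU]; have [Hw|Hw] := pselect (H w); [left|right; tauto].
rewrite measureU//; last 3 first.
- exact: measurableI.
- by apply: measurableI => //; exact: measurableD.
- by apply/seteqP; split => w //= [[_ Hw] [[_ /(_ Hw)]]].
rewrite ge0_muleDr//.
apply: (@le_trans _ _ (P ((E `&` H) `&` G) + P ((E `\` H) `&` V))%E).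
  apply: leeD.
    rewrite GE (indep_past_ball l0')//; last 2 first.
    - exact: ltW.
    - move=> r; rewrite inE => /predU1P[->|rl0]; first by rewrite lexx ltW.
      by rewrite l00//= l0l// mem_head.
    rewrite muleC lee_wpmul2l//.
    have := lk q (mem_head _ _); congr (_ <= P _)%E.
    by apply/seteqP; split => w /=; rewrite subr0.
  apply: (IH l0') => //.
  - exact: path_sorted sl.
  - by move=> r rl; apply: lv; rewrite inE rl orbT.
  - move=> r p; rewrite inE => /predU1P[->|rl0] pl; first exact: ql.
    by apply: l0l => //; rewrite inE pl orbT.
  - by move=> r rl; apply: lk; rewrite inE rl orbT.
rewrite -measureU//; last 3 first.
- by apply: measurableI => //; exact: measurableI.
- by apply: measurableI => //; exact: measurableD.
- by apply/seteqP; split => w //= [[[_ Hw] _] [[_ /(_ Hw)]]].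
apply: le_measure; rewrite ?inE.
- apply: measurableU; first by apply: measurableI => //; exact: measurableI.
  by apply: measurableI => //; exact: measurableD.
- by apply: measurableI => //; apply: measurableU => //; exact: measurableI.
- by move=> w /=; tauto.
Qed.

Lemma ottaviani (l : seq R) (v g kappa : R) (h : R -> 'rV[R]_d) (c : R -> R) :
  0 <= kappa -> (forall q, q \in l -> 0 < q < v) ->
  (forall q, q \in l -> kappa%:E <= P [set w | (eucl_norm (Y (v - q) w) < g)%R])%E ->
  (kappa%:E * P (\big[setU/set0]_(q <- l)
      [set w | (eucl_norm (Y q w - h q) < c q)%R]) <=
   P (\big[setU/set0]_(q <- l)
      ([set w | (eucl_norm (Y q w - h q) < c q)%R] `&`
       [set w | (eucl_norm (Y v w - Y q w) < g)%R])))%E.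
Proof.
move=> k0 lv lk; pose l' := sort <=%R l.
have := ottaviani_past [::] l' v g kappa h c setT k0.
rewrite !setTI !(perm_big _ (permEl (perm_sort <=%R l)))/=; apply.
- exact/sort_sorted/le_total.
- by move=> q; rewrite mem_sort; exact: lv.
- by [].
- by [].
- by move=> q; rewrite mem_sort; exact: lk.
- exact: (@measurableT _ (g_sigma_algebraType (past [::]))).
Qed.

End PastIndependence.

(** * Regularity of the normalization *)

(** The common deterministic estimate of both directions: moving from time [u] to time [v] costs one
    [e] for the increment [y] and one for the displacement of the centre from [bu *: x] to
    [bv *: x]. *)
Lemma ball_transfer {R : realType} {d : nat} (x z y : 'rV[R]_d) (bu bv e e' : R) :
  0 <= e' -> bu <= bv -> eucl_norm (z - bu *: x) < e' * bu ->
  eucl_norm y <= e * bv -> (bv - bu) * eucl_norm x <= e * bv ->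
  eucl_norm (z + y - bv *: x) < (e' + 2 * e) * bv.
Proof.
move=> e'0 uv zx yv bx.
have -> : z + y - bv *: x = (z - bu *: x) + (y + (- (bv - bu)) *: x).
  by rewrite addrACA -!scaleNr -scalerDl; congr (_ + _ *: _); ring.
rewrite (le_lt_trans (ler_eucl_normD _ _ _ _))//.
have := ler_eucl_normD _ _ y (- (bv - bu) *: x).
rewrite eucl_normZ normrN ger0_norm ?subr_ge0//.
have : e' * bu <= e' * bv by rewrite ler_wpM2l.
by nra.
Qed.

(* Everything that is used of conditions (i), (ii) and of stochastic
   boundedness; (i) only matters through [b (eta v) <= eta^rho b v]. *)
Definition slowly_spread {dT : measure_display} {T : measurableType dT}
    {R : realType} (P : probability T R) (d : nat) (Y : R -> T -> 'rV[R]_d)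
    (b : R -> R) (x : 'rV[R]_d) :=
  forall e kappa : R, 0 < e -> kappa < 1 -> exists theta s0 : R,
    [/\ 1 < theta, 0 < s0 <= 1 & forall u v, 0 < u -> u < v -> v <= s0 ->
      v <= theta * u ->
      (b v - b u) * eucl_norm x <= e * b v /\
      (kappa%:E <= P [set w | (eucl_norm (Y (v - u) w) < e * b v)%R])%E].

(** For [v / u] near 1, condition (ii) makes [b u / b v] near 1, which bounds the displacement of
    the centre. Condition (i) makes [b (v - u)] a small multiple of [b v], so that stochastic
    boundedness at time [v - u] controls the increment. *)
Lemma slowly_spread_of_bounded {dT : measure_display} {T : measurableType dT}
    {R : realType} (P : probability T R) (d : nat) (Y : R -> T -> 'rV[R]_d)
    (b : R -> R) (x : 'rV[R]_d) (t0 rho : R) :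
  centered_levy P d Y ->
  (forall t, 0 < t <= 1 -> 0 < b t) ->
  (forall s t, 0 < s -> s <= t -> t <= 1 -> b s <= b t) ->
  0 < t0 <= 1 -> 0 < rho ->
  (forall s t, 0 < s -> s <= t -> t <= t0 -> b s / s `^ rho <= b t / t `^ rho) ->
  (forall eps : R, 0 < eps -> exists2 de : R, 0 < de < t0 &
     forall s t, 0 <= s -> s <= t -> t <= de -> (1 - eps) * (s / t) <= b s / b t) ->
  (forall de : R, 0 < de -> exists K td : R,
     [/\ 0 < K, 0 < td < 1 &
       forall t, 0 < t < td ->
         (P [set w | (K * b t < eucl_norm (Y t w))%R] < de%:E)%E]) ->
  slowly_spread P d Y b x.
Proof.
move=> LY bpos bmono /andP[t00 t01] rho0 hi hii hK e kappa e0 kappa1.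
have [K [td [K0 /andP[td0 td1] hKt]]] := hK (1 - kappa) ltac:(by rewrite subr_gt0).
(* The added 1 keeps the divisor positive when [x = 0]. *)
pose X1 := eucl_norm x + 1.
have X10 : 0 < X1 by rewrite ltr_wpDl// eucl_norm_ge0.
have [de /andP[de0 det0] hde] := hii (e / (2 * X1)) ltac:(by rewrite divr_gt0// mulr_gt0).
pose c := e / (2 * K).
have c0 : 0 < c by rewrite divr_gt0// mulr_gt0.
pose eta := Num.min (2^-1) (Num.min (e / (2 * X1)) (c `^ (rho^-1))).
have eta0 : 0 < eta.
  by rewrite /eta !lt_min invr_gt0 ltr0n powR_gt0// divr_gt0// mulr_gt0.
have eta2 : eta <= 2^-1 by rewrite /eta ge_min lexx.
have etaX : eta <= e / (2 * X1) by rewrite /eta !ge_min lexx !orbT.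
have etac : eta <= c `^ (rho^-1) by rewrite /eta !ge_min lexx !orbT.
have etar : eta `^ rho <= c.
  rewrite -[leRHS](powRr1 (ltW c0)) -(mulVf (lt0r_neq0 rho0)) powRrM.
  by rewrite ge0_ler_powR ?nnegrE ?powR_ge0// ltW.
have eta1 : eta < 1 by rewrite (le_lt_trans eta2)// invf_lt1// ltr1n.
exists (1 + eta), (Num.min de td); split.
- by rewrite ltrDl.
- by rewrite lt_min de0 td0/= ge_min (ltW td1) orbT.
move=> u v u0 uv; rewrite le_min => /andP[vde vtd] vu.
have v0 : 0 < v by exact: lt_trans uv.
have v1 : v <= 1 by rewrite (le_trans vtd)// ltW.
have vt0 : v <= t0 by rewrite (le_trans vde)// ltW.
have bv0 : 0 < b v by rewrite bpos// v0.
have vuv : v - u <= eta * v.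
  have : eta * u <= eta * v by rewrite ler_pM2l// ltW.
  by lra.
split.
  have := hde u v (ltW u0) (ltW uv) vde; rewrite ler_pdivlMr// => hb.
  have uv1 : 1 - eta <= u / v by rewrite ler_pdivlMr//; lra.
  have uv2 : u / v <= 1 by rewrite ler_pdivrMr// mul1r ltW.
  set ep := e / (2 * X1) in hb etaX.
  have ep0 : 0 < ep by rewrite divr_gt0// mulr_gt0.
  have hb' : b v - b u <= 2 * ep * b v.
    have epuv : ep * (u / v) <= ep by rewrite ler_piMr// ltW.
    have : (1 - 2 * ep) * b v <= (1 - ep) * (u / v) * b v.
      by rewrite ler_pM2r//; lra.
    by lra.
  have -> : e * b v = 2 * ep * b v * X1.
    by rewrite /ep; field; rewrite lt0r_neq0.
  apply: ler_pM => //.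
  - by rewrite subr_ge0 bmono// ltW.
  - exact: eucl_norm_ge0.
  - by rewrite /X1 lerDl.
have vu0 : 0 < v - u by rewrite subr_gt0.
have vutd : v - u < td by rewrite (lt_le_trans _ vtd)// ltrBlDr ltrDl.
have Kb : K * b (v - u) < e * b v.
  have ev0 : 0 < eta * v by rewrite mulr_gt0.
  have evv : eta * v <= v by rewrite ler_piMl// ltW.
  have h1 : b (v - u) <= b (eta * v) by rewrite bmono// (le_trans evv).
  have := hi (eta * v) v ev0 evv vt0.
  rewrite (powRM _ (ltW eta0) (ltW v0)) ler_pdivrMr ?mulr_gt0 ?powR_gt0//.
  have -> : b v / v `^ rho * (eta `^ rho * v `^ rho) = b v * eta `^ rho.
    by field; rewrite lt0r_neq0// powR_gt0.
  move=> h2; have h3 : b v * eta `^ rho <= b v * c by rewrite ler_pM2l.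
  have h4 : K * b (v - u) <= K * (b v * c).
    by rewrite ler_pM2l// (le_trans h1)// (le_trans h2).
  apply: (le_lt_trans h4).
  have -> : K * (b v * c) = e * b v / 2 by rewrite /c; field; rewrite lt0r_neq0.
  by rewrite ltr_pdivrMr// ltr_pMr ?mulr_gt0// ltr1n.
have hP := hKt (v - u) ltac:(by rewrite vu0 vutd).
have mB := measurable_ball P d Y LY (v - u) 0 (e * b v) (ltW vu0).
have BE : [set w | eucl_norm (Y (v - u) w - 0) < e * b v] =
    [set w | eucl_norm (Y (v - u) w) < e * b v].
  by apply/seteqP; split => w /=; rewrite subr0.
rewrite BE in mB.
have mK : measurable [set w | K * b (v - u) < eucl_norm (Y (v - u) w)].
  have [mY _ _ _] := LY.
  have mN : measurable_fun setT (fun w => eucl_norm (Y (v - u) w)).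
    by apply: measurable_eucl_norm => i; apply: mY; exact: ltW.
  have := mN measurableT `]K * b (v - u), +oo[%classic (measurable_itv _).
  rewrite setTI; congr measurable; apply/seteqP; split => w /=;
    by rewrite in_itv/= andbT.
have : (P (~` [set w | (K * b (v - u) < eucl_norm (Y (v - u) w))%R]) <=
        P [set w | (eucl_norm (Y (v - u) w) < e * b v)%R])%E.
  apply: le_measure; rewrite ?inE//; first exact: measurableC.
  by move=> w /= /negP; rewrite -leNgt => /le_lt_trans; apply.
apply: le_trans; rewrite probability_setC//.
rewrite -[P _]fineK ?fin_num_measure// in hP *.
by rewrite -EFinB lee_fin; rewrite lte_fin in hP; lra.
Qed.

(** * Integrals over geometric blocks *)

Section StepIntegrals.
Context {dT : measure_display} {T : measurableType dT} {R : realType}.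
Variable mu : {measure set T -> \bar R}.
Import HBNNSimple.

(* Unlike [ge0_le_integral], no measurability: [\int] is a supremum over simple functions. *)
Lemma ge0_le_integral_nonmeasurable (D : set T) (f g : T -> \bar R) :
  (forall v, D v -> (0 <= f v)%E) -> (forall v, D v -> (f v <= g v)%E) ->
  (\int[mu]_(v in D) f v <= \int[mu]_(v in D) g v)%E.
Proof.
move=> f0 fg; rewrite !ge0_integralE//; last first.
  by move=> v Dv; rewrite (le_trans (f0 v Dv))// fg.
apply: ereal_sup_le => _ [h hf <-].
exists h => // v; apply: le_trans (hf v) _.
rewrite /patch; case: ifPn => // /set_mem Dv; exact: fg.
Qed.
End StepIntegrals.

Section GeometricBlocks.
Context {R : realType}.
Variables (t0 lam : R).
Hypotheses (t00 : 0 < t0) (t01 : t0 <= 1) (lam1 : 1 < lam).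

Let lam0 : 0 < lam. Proof. exact: lt_trans lam1. Qed.

Lemma geom_gt0 k : 0 < t0 * lam ^- k.
Proof. by rewrite mulr_gt0// invr_gt0 exprn_gt0. Qed.

Lemma geom_anti j k : (j <= k)%N -> t0 * lam ^- k <= t0 * lam ^- j.
Proof.
move=> jk; rewrite ler_pM2l// lef_pV2 ?posrE ?exprn_gt0//.
by rewrite ler_weXn2l// ltW.
Qed.

Lemma geomS k : t0 * lam ^- k = lam * (t0 * lam ^- k.+1).
Proof. by rewrite exprS invfM mulrCA (mulrA lam) mulfV ?mul1r// lt0r_neq0. Qed.

Lemma geom_le1 k : t0 * lam ^- k <= 1.
Proof.
have := geom_anti 0 k (leq0n k); rewrite expr0 invr1 mulr1.
by move=> /le_trans; apply.
Qed.

Lemma geom_lt_eventually (r : R) : 0 < r -> exists k, t0 * lam ^- k < r.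
Proof.
move=> r0; have l1 : `|lam^-1| < 1.
  by rewrite ger0_norm ?invr_ge0 ?ltW// invf_lt1.
have := cvg_expr l1 => /cvgrPdist_lt /(_ (r / t0)).
rewrite divr_gt0// => /(_ isT) [N _ /(_ N (leqnn N))] /=.
rewrite sub0r normrN ger0_norm ?exprn_ge0 ?invr_ge0 ?ltW//.
by rewrite ltr_pdivlMr// mulrC exprVn => ?; exists N.
Qed.

Lemma geom_block_exists (r : R) (K : nat) : 0 < r -> r < t0 * lam ^- K ->
  exists2 k, (K <= k)%N & t0 * lam ^- k.+1 <= r < t0 * lam ^- k.
Proof.
move=> r0 rK; have [m0 tm0] := geom_lt_eventually r r0.
have ex : exists m, t0 * lam ^- m <= r by exists m0; exact: ltW.
case: (ex_minnP ex) => m tm mmin.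
have Km : (K < m)%N.
  rewrite ltnNge; apply/negP => mK.
  by have := geom_anti m K mK; rewrite leNgt (le_lt_trans tm).
case: m => // m in tm mmin Km *; exists m => //.
by rewrite tm/= ltNge; apply/negP => /mmin; rewrite ltnn.
Qed.

Lemma geom_block_uniq (v : R) j k : t0 * lam ^- j.+1 <= v < t0 * lam ^- j ->
  t0 * lam ^- k.+1 <= v < t0 * lam ^- k -> j = k.
Proof.
move=> /andP[j1 j2] /andP[k1 k2]; apply/eqP; rewrite eqn_leq; apply/andP; split.
  rewrite leqNgt; apply/negP => kj.
  by have := geom_anti k.+1 j kj; rewrite leNgt (le_lt_trans k1).
rewrite leqNgt; apply/negP => jk.
by have := geom_anti j.+1 k jk; rewrite leNgt (le_lt_trans j1).
Qed.

Let J k : set R := `[t0 * lam ^- k.+1, t0 * lam ^- k[%classic.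

Let measJ k : lebesgue_measure (J k) = (t0 * lam ^- k - t0 * lam ^- k.+1)%:E.
Proof.
rewrite /J lebesgue_measure_itv/= lte_fin.
by rewrite [ltRHS]geomS ltr_pMl ?geom_gt0// lam1 EFinB.
Qed.

Let J_sub k : J k `<=` (`]0, 1] : set R).
Proof.
move=> v; rewrite /J /= !in_itv/= => /andP[v1 v2].
by rewrite (lt_le_trans (geom_gt0 _) v1)/= (le_trans (ltW v2))// geom_le1.
Qed.

Let integralJ k (a : R) : 0 <= a ->
  (\int[lebesgue_measure]_(v in (`]0%R, 1%R] : set R)) (a * \1_(J k) v)%:E =
   (a * (t0 * lam ^- k - t0 * lam ^- k.+1))%:E)%E.
Proof.
move=> a0; under eq_integral do rewrite EFinM.
rewrite ge0_integralZl//; last first.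
  by apply/measurable_EFinP; apply: measurable_indic; exact: measurable_itv.
rewrite integral_indic//; last exact: measurable_itv.
rewrite setIidl; last exact: J_sub.
by rewrite EFinM; congr (_ * _)%E; exact: measJ.
Qed.

(** On block [k], [v^-1] is at least the inverse of the right endpoint, and the block length divided
    by that endpoint is [1 - lam^-1]. The step function [phi] realizes this minorant. *)
Lemma geom_integral_ge (f : R -> \bar R) (g : nat -> R) (n : nat) :
  (forall v, (0 <= f v)%E) -> (forall k, 0 <= g k) ->
  (forall k v, t0 * lam ^- k.+1 <= v < t0 * lam ^- k -> ((g k)%:E <= f v)%E) ->
  ((\sum_(k < n) g k * (1 - lam^-1))%:E <=
   \int[lebesgue_measure]_(v in (`]0%R, 1%R] : set R)) ((v^-1)%:E * f v))%E.
Proof.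
move=> f0 g0 gf.
pose phi k v : R := ((t0 * lam ^- k)^-1 * g k) * \1_(J k) v.
have phi0 k v : 0 <= phi k v.
  by rewrite mulr_ge0// mulr_ge0// invr_ge0 ltW// geom_gt0.
have -> : (\sum_(k < n) g k * (1 - lam^-1))%:E =
   (\int[lebesgue_measure]_(v in (`]0%R, 1%R] : set R))
     \sum_(k < n) (phi k v)%:E)%E.
  rewrite ge0_integral_sum//; last 2 first.
  - move=> k; apply/measurable_EFinP; apply: measurable_funM => //.
    by apply: measurable_indic; exact: measurable_itv.
  - by move=> k v _; rewrite lee_fin.
  rewrite -sumEFin; apply: eq_bigr => k _; rewrite integralJ; last first.
    by rewrite mulr_ge0// invr_ge0 ltW// geom_gt0.
  congr EFin; rewrite exprS; field.
  by rewrite !lt0r_neq0// exprn_gt0.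
apply: ge0_le_integral_nonmeasurable => v.
  by rewrite /= in_itv/= => _; apply: sume_ge0 => k _; rewrite lee_fin.
rewrite /= in_itv/= => /andP[v0 v1].
have [[k vk]|nJ] := pselect (exists k : 'I_n, J k v); last first.
  rewrite big1 ?mule_ge0 ?lee_fin ?invr_ge0 ?(ltW v0)// => k _.
  congr EFin; rewrite /phi indicE memNset ?mulr0// => vk.
  by apply: nJ; exists k.
rewrite (bigD1 k)//= big1 ?adde0; last first.
  move=> j jk; congr EFin; rewrite /phi indicE memNset ?mulr0// => vj.
  move/eqP: jk; apply; apply/val_inj/(@geom_block_uniq v).
    by move: vj; rewrite /J/= in_itv.
  by move: vk; rewrite /J/= in_itv.
rewrite /phi indicE mem_set// mulr1.
move: vk; rewrite /J /= in_itv/= => vk.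
rewrite EFinM; apply: lee_pmul; rewrite ?lee_fin ?invr_ge0 ?(ltW (geom_gt0 _))//.
  have /andP[_ /ltW vk2] := vk.
  by rewrite lef_pV2 ?posrE ?geom_gt0.
exact: gf.
Qed.

(** On block [k], [v^-1] is at most the inverse of the left endpoint, and the block length divided
    by that endpoint is [lam - 1]; the blocks contribute at most [C * (lam - 1)]. *)
Lemma geom_integral_lty (f : R -> \bar R) (g : nat -> R) (C : R) :
  (forall v, 0 < v -> (0 <= f v <= 1)%E) -> (forall k, 0 <= g k) ->
  (forall k v, t0 * lam ^- k.+1 <= v < t0 * lam ^- k -> (f v <= (g k)%:E)%E) ->
  (forall n, \sum_(k < n) g k <= C) ->
  (\int[lebesgue_measure]_(v in (`]0%R, 1%R] : set R)) ((v^-1)%:E * f v) < +oo)%E.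
Proof.
move=> f01 g0 gf gC.
have f0 v : 0 < v -> (0 <= f v)%E by move=> /f01/andP[].
pose phi k v : R := ((t0 * lam ^- k.+1)^-1 * g k) * \1_(J k) v.
have phi0 k v : 0 <= phi k v.
  by rewrite mulr_ge0// mulr_ge0// invr_ge0 ltW// geom_gt0.
(* The extra term of index 0 covers the times in [[t0, 1]], outside all blocks, where the integrand
   is at most [t0^-1]. *)
pose psi k v : R := if k is k'.+1 then phi k' v else t0^-1.
have psi0 k v : 0 <= psi k v.
  by case: k => [|k] /=; rewrite ?phi0// invr_ge0 ltW.
apply: (@le_lt_trans _ _ (\int[lebesgue_measure]_(v in (`]0%R, 1%R] : set R))
     \sum_(0 <= k <oo) (psi k v)%:E)%E).
  apply: ge0_le_integral_nonmeasurable => v; rewrite /= in_itv/= => /andP[v0 v1].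
    by rewrite mule_ge0 ?f0// lee_fin invr_ge0 ltW.
  have [vt|vt] := leP t0 v.
    apply: (@le_trans _ _ (psi 0%N v)%:E).
      rewrite /= -[leRHS]mule1; apply: lee_pmul.
      - by rewrite lee_fin invr_ge0 ltW.
      - exact: f0.
      - by rewrite lee_fin lef_pV2.
      - by have /andP[] := f01 v v0.
    apply: le_trans (nneseries_lim_ge 1 _); first by rewrite big_nat1.
    by move=> k _ _; rewrite lee_fin.
  have [k _ vk] : exists2 k, (0 <= k)%N & t0 * lam ^- k.+1 <= v < t0 * lam ^- k.
    by apply: geom_block_exists => //; rewrite expr0 invr1 mulr1.
  apply: (@le_trans _ _ (psi k.+1 v)%:E).
    rewrite /= /phi indicE mem_set ?mulr1; last by rewrite /J/= in_itv.
    rewrite EFinM; apply: lee_pmul; rewrite ?lee_fin ?invr_ge0 ?(ltW v0) ?f0//.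
      have /andP[vk2 _] := vk.
      by rewrite lef_pV2 ?posrE ?geom_gt0.
    exact: gf.
  apply: le_trans (nneseries_lim_ge k.+2 _); last first.
    by move=> j _ _; rewrite lee_fin.
  by rewrite big_nat_recr//= leeDr// sume_ge0// => j _; rewrite lee_fin.
rewrite integral_nneseries//; last 2 first.
- case=> [|k]; apply/measurable_EFinP; first exact: measurable_cst.
  rewrite /psi /phi; apply: measurable_funM => //.
  by apply: measurable_indic; exact: measurable_itv.
- by move=> k v _; rewrite lee_fin.
apply: (@le_lt_trans _ _ (t0^-1 + C * (lam - 1))%:E); last by rewrite ltry.
apply: lime_le.
  apply: is_cvg_nneseries => k _ _.
  by apply: integral_ge0 => v _; rewrite lee_fin.
apply: nearW => -[|n].
  rewrite big_nil lee_fin addr_ge0 ?invr_ge0 ?(ltW t00)//.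
  have := gC 0%N; rewrite big_ord0 => C0.
  by rewrite mulr_ge0// subr_ge0 ltW.
rewrite big_nat_recl//= EFinD leeD//.
  rewrite integral_cst//= lebesgue_measure_itv/= lte_fin ltr01.
  by rewrite sube0 mule1.
rewrite big_mkord (eq_bigr (fun k : 'I_n => (g k * (lam - 1))%:E)); last first.
  move=> k _; rewrite integralJ; last first.
    by rewrite mulr_ge0// invr_ge0 ltW// geom_gt0.
  congr EFin; rewrite exprS; field.
  by rewrite !lt0r_neq0// exprn_gt0.
by rewrite sumEFin lee_fin -mulr_suml ler_wpM2r ?gC// subr_ge0 ltW.
Qed.

End GeometricBlocks.

(** * Cluster points *)

(** A difference over [r] steps splits into [r] one-step differences; for each of them the sum over
    [k] telescopes to a difference of two numbers in [[0, 1]]. *)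
Lemma sum_shift_diff_le {R : realType} (a : nat -> R) (n r : nat) :
  (forall k, 0 <= a k <= 1) -> \sum_(k < n) (a k - a (k + r)%N) <= r%:R.
Proof.
move=> a01; elim: r => [|r IH].
  by rewrite big1// => k _; rewrite addn0 subrr.
rewrite (eq_bigr (fun k : 'I_n => (a k - a (k + r)%N) +
    (a (k + r)%N - a (k + r).+1))); last first.
  by move=> k _; rewrite addrA subrK addnS.
rewrite big_split/= -natr1 lerD//.
rewrite -(big_mkord predT (fun k => a (k + r)%N - a (k + r).+1)).
have -> : \sum_(0 <= k < n) (a (k + r)%N - a (k + r).+1) = a r - a (n + r)%N.
  elim: n {IH} => [|n IHn]; first by rewrite big_nil subrr.
  by rewrite big_nat_recr//= IHn addrA subrK.
by have /andP[_ ?] := a01 r; have /andP[? _] := a01 (n + r)%N; lra.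
Qed.

Lemma probability_setI_ge {dT : measure_display} {T : measurableType dT}
    {R : realType} (P : probability T R) (A B : set T) :
  measurable A -> measurable B ->
  fine (P A) + fine (P B) - 1 <= fine (P (A `&` B)).
Proof.
move=> mA mB.
have mAB : measurable (A `\` B) by exact: measurableD.
have mI : measurable (A `&` B) by exact: measurableI.
have le : (P (A `\` B) <= P (~` B))%E.
  apply: le_measure; rewrite ?inE//; first exact: measurableC.
rewrite (measureDI P mA mB) fineD ?fin_num_measure//.
rewrite probability_setC// -(fineK (fin_num_measure P _ mAB)) in le.
rewrite -(fineK (fin_num_measure P _ mB)) -EFinB lee_fin in le.
by lra.
Qed.

Lemma eucl_normalized_ltE {dT : measure_display} {T : measurableType dT} {R : realType}
    (d : nat) (Y : R -> T -> 'rV[R]_d) (b : R -> R) (x : 'rV[R]_d) (e t : R) (w : T) :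
  0 < b t ->
  (eucl_norm ((b t)^-1 *: Y t w - x) < e) =
  (eucl_norm (Y t w - b t *: x) < e * b t).
Proof.
move=> bt; have -> : (b t)^-1 *: Y t w - x = (b t)^-1 *: (Y t w - b t *: x).
  by rewrite scalerBr scalerA mulVf ?scale1r// lt0r_neq0.
by rewrite eucl_normZ ger0_norm ?invr_ge0 ?(ltW bt)// ltr_pdivrMl// mulrC.
Qed.

(** Moves a visit at a real time to a rational time shortly after it; [f] will be the distance from
    the position at time [u]. *)
Lemma right_continuous_ratr {R : realType} (f : R -> R) (u r e : R) : u < r -> 0 < e ->
  f s @[s --> u^'+] --> (0 : R) ->
  exists2 q : rat, u < ratr q < r & f (ratr q) < e.
Proof.
move=> ur e0 /cvgrPdist_lt /(_ e e0) fe.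
have [de /= de0 hde] := fe.
have um : u < Num.min r (u + de) by rewrite lt_min ur ltrDl.
have [q] := rat_in_itvoo um; rewrite in_itv/= lt_min => /and3P[uq qr qde].
exists q; first by rewrite uq.
have := hde (ratr q); rewrite /ball_/= ltr0_norm ?subr_lt0// opprB ltrBlDl => /(_ qde uq).
by rewrite sub0r normrN; exact/le_lt_trans/ler_norm.
Qed.

(** * Visits near the moving centre and the two implications *)

Section ClusterPoints.
Context {dT : measure_display} {T : measurableType dT} {R : realType}.
Variables (P : probability T R) (d : nat) (Y : R -> T -> 'rV[R]_d).
Variables (b : R -> R) (x : 'rV[R]_d).
Hypothesis LY : centered_levy P d Y.
Hypothesis bpos : forall t, 0 < t <= 1 -> 0 < b t.
Hypothesis bmono : forall s t, 0 < s -> s <= t -> t <= 1 -> b s <= b t.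
Hypothesis SS : slowly_spread P d Y b x.

(** The event that [Y t / b t] is within [e] of [x], multiplied out by [b t]. *)
Definition hit (e t : R) : set T :=
  [set w | eucl_norm (Y t w - b t *: x) < e * b t].

Lemma measurable_hit e t : 0 <= t -> measurable (hit e t).
Proof. by move=> t0; apply: (measurable_ball P). Qed.

(** Finite lists, taken by rational codes below [n], that exhaust the rationals of the interval: the
    Ottaviani inequality applies to each list, and a monotone limit gives all rational times. *)
Definition rational_times (a c : R) (n : nat) : seq R :=
  [seq ratr q | q <- pmap (@unpickle rat) (iota 0 n) & a < ratr q < c].

Lemma rational_timesP a c n (r : R) : r \in rational_times a c n -> a < r < c.
Proof. by move=> /mapP[q]; rewrite mem_filter => /andP[? _] ->. Qed.

Lemma mem_rational_times a c (q : rat) : a < ratr q < c ->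
  exists n, (ratr q : R) \in rational_times a c n.
Proof.
move=> aqc; exists (pickle q).+1; apply/mapP; exists q => //.
rewrite mem_filter aqc andTb mem_pmap; apply/mapP; exists (pickle q).
  by rewrite mem_iota leq0n add0n ltnSn.
by rewrite pickleK.
Qed.

Lemma rational_times_sub a c m n : (m <= n)%N ->
  {subset rational_times a c m <= rational_times a c n}.
Proof.
move=> mn r /mapP[q]; rewrite mem_filter mem_pmap => /andP[aqc /mapP[i]].
rewrite mem_iota/= => im qi ->; apply/mapP; exists q => //.
rewrite mem_filter aqc andTb mem_pmap; apply/mapP; exists i => //.
by rewrite mem_iota/= (leq_trans im).
Qed.

Definition rational_hit (e a c : R) : set T :=
  \bigcup_n \big[setU/set0]_(q <- rational_times a c n) hit e q.

Lemma rational_hitP e a c (q : rat) w : a < ratr q < c -> hit e (ratr q) w ->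
  rational_hit e a c w.
Proof.
move=> /mem_rational_times[n qn] hw; exists n => //.
by rewrite -bigcup_seq; exists (ratr q).
Qed.

Lemma measurable_big_hit e a c n : 0 <= a ->
  measurable (\big[setU/set0]_(q <- rational_times a c n) hit e q).
Proof.
move=> a0; rewrite big_seq; apply: bigsetU_measurable => q /rational_timesP.
move=> /andP[aq _]; apply: measurable_hit.
by rewrite (le_trans a0)// ltW.
Qed.

Lemma measurable_rational_hit e a c : 0 <= a -> measurable (rational_hit e a c).
Proof. by move=> a0; apply: bigcupT_measurable => n; exact: measurable_big_hit. Qed.

(** Ottaviani with the moving centres [b q *: x]: a visit at [q] followed by a small increment up to
    [v] is, by [ball_transfer], a visit at [v]. Continuity from below passes from finite lists to
    all rational times. *)
Lemma rational_hit_le e e' kappa : 0 < e -> 0 <= e' -> 0 < kappa -> kappa < 1 ->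
  exists theta s0 : R, [/\ 1 < theta, 0 < s0 <= 1 &
    forall a c v, 0 < a -> 0 < v -> c <= v -> v <= theta * a -> v <= s0 ->
      (kappa%:E * P (rational_hit e' a c) <= P (hit (e' + 2 * e) v))%E].
Proof.
move=> e0 e'0 k0 k1; have [theta [s0 [th1 s01 hs]]] := SS e kappa e0 k1.
exists theta, s0; split => // a c v a0 v0 cv vth vs0.
have main n : (kappa%:E * P (\big[setU/set0]_(q <- rational_times a c n) hit e' q)
    <= P (hit (e' + 2 * e) v))%E.
  have qv q : q \in rational_times a c n -> [/\ 0 < q, q < v & v <= theta * q].
    move=> /rational_timesP/andP[aq qc]; split.
    - exact: lt_trans aq.
    - exact: lt_le_trans cv.
    - by rewrite (le_trans vth)// ler_pM2l ?ltW// (lt_trans _ th1).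
  have := ottaviani P d Y LY (rational_times a c n) v (e * b v) kappa
    (fun q => b q *: x) (fun q => e' * b q) (ltW k0).
  move=> /(_ _ _)/le_trans; apply.
  - by move=> q /qv[q0 qv' _]; rewrite q0.
  - by move=> q /qv[q0 qv' vq]; have [] := hs q v q0 qv' vs0 vq.
  apply: le_measure; rewrite ?inE.
  - rewrite big_seq; apply: bigsetU_measurable => q qn.
    have [q0 _ _] := qv q qn; apply: measurableI; first exact/measurable_hit/ltW.
    have := measurable_ball_incr P d Y LY q v 0 (e * b v) (ltW q0) (ltW v0).
    by congr measurable; apply/seteqP; split => w /=; rewrite subr0.
  - exact/measurable_hit/ltW.
  - move=> w; rewrite -bigcup_seq => -[q qn /= [hq qw]].
    have [q0 qv' vq] := qv q qn; have [bx _] := hs q v q0 qv' vs0 vq.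
    have bqv : b q <= b v.
      by apply: bmono => //; [exact: ltW|rewrite (le_trans vs0)//; case/andP: s01].
    have := ball_transfer x (Y q w) (Y v w - Y q w) (b q) (b v) e e' e'0 bqv hq (ltW qw) bx.
    by rewrite addrCA subrr addr0.
rewrite -lee_pdivlMl//.
have nd : nondecreasing_seq (fun n =>
    \big[setU/set0]_(q <- rational_times a c n) hit e' q).
  move=> m n mn; apply/subsetPset => w; rewrite -!bigcup_seq => -[q qm hq].
  by exists q => //; exact: rational_times_sub qm.
have cv' := nondecreasing_cvg_mu (mu := P)
  (fun n => measurable_big_hit e' a c n (ltW a0))
  (measurable_rational_hit e' a c (ltW a0)) nd.
rewrite -(cvg_lim _ cv')//; apply: lime_le; first exact: cvgP cv'.
by apply: nearW => n /=; rewrite lee_pdivlMl.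
Qed.

(** Each late visit of the clustering sequence falls in some geometric block, and right continuity
    produces a rational visit later in the same block, at scale [3 * e]. Hence infinitely many
    blocks are visited. *)
Lemma cluster_rational_hit (theta s0 t0 lam e : R) (w : T) :
  0 < e -> 0 < t0 -> t0 <= 1 -> t0 <= s0 -> 1 < lam -> lam <= theta ->
  (forall u v, 0 < u -> u < v -> v <= s0 -> v <= theta * u ->
     (b v - b u) * eucl_norm x <= e * b v) ->
  (forall t, 0 <= t ->
     (fun s => eucl_norm (Y s w - Y t w)) @ t^'+ --> (0 : R)) ->
  cluster_set (fun t => (b t)^-1 *: Y t w) x ->
  lim_sup_set (fun k => rational_hit (e + 2 * e)
     (t0 * lam ^- k.+2) (t0 * lam ^- k.+1)) w.
Proof.
move=> e0 t00 t01 t0s0 lam1 lamth hs rc [u [u0 ucv Ycv]] K _.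
have tK0 : 0 < t0 * lam ^- K.+1 by exact: geom_gt0.
move/cvgrPdist_lt : ucv => /(_ _ tK0) ucv.
move/cvgrPdist_lt : Ycv => /(_ _ e0) Ycv.
have [n /=] := @filter_ex _ _ _ _ (filterI ucv Ycv).
rewrite !sub0r !normrN !ger0_norm ?eucl_norm_ge0 ?(ltW (u0 n))// => -[uK Yu].
(* Starting from [K.+1] ensures that the block index is a successor [k.+1] with [K <= k], which
   matches the shift in the statement. *)
have [m Km /andP[mu um]] := geom_block_exists t0 lam t00 lam1 (u n) K.+1 (u0 n) uK.
case: m => // k in Km mu um *; exists k => //.
have un1 : u n <= 1 by rewrite (le_trans (ltW um))// geom_le1.
have bu0 : 0 < b (u n) by rewrite bpos// u0.
rewrite eucl_normalized_ltE// in Yu.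
have [q /andP[uq qk] Yq] :=
  right_continuous_ratr _ _ _ _ um (mulr_gt0 e0 bu0) (rc _ (ltW (u0 n))).
have qt0 : (ratr q : R) <= t0.
  rewrite (le_trans (ltW qk))//.
  have := geom_anti t0 lam t00 lam1 0 k.+1 (leq0n _).
  by rewrite expr0 invr1 mulr1.
apply: (rational_hitP _ _ _ q).
  by rewrite qk andbT (le_lt_trans mu).
have buq : b (u n) <= b (ratr q) by rewrite bmono ?(ltW uq)// (le_trans qt0).
have bx : (b (ratr q) - b (u n)) * eucl_norm x <= e * b (ratr q).
  apply: hs => //; first exact: le_trans t0s0.
  rewrite (le_trans (ltW qk))// geomS; last exact: lam1.
  by apply: ler_pM => //; [rewrite ltW// (lt_trans _ lam1)|rewrite ltW// geom_gt0].
have Yqe : eucl_norm (Y (ratr q) w - Y (u n) w) <= e * b (ratr q).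
  by rewrite (le_trans (ltW Yq))// ler_pM2l.
have := ball_transfer x _ _ _ _ e e (ltW e0) buq Yu Yqe bx.
by rewrite addrCA subrr addr0.
Qed.

(** Half the probability of a visit in block [k.+1] bounds the integrand's probability from below
    throughout block [k]. A finite integral would make these probabilities summable, and
    Borel-Cantelli would contradict the infinitely many visited blocks. *)
Lemma cluster_integral_infinite (e0 : R) : 0 < e0 ->
  {ae P, forall w, forall t, 0 <= t ->
     (fun s => eucl_norm (Y s w - Y t w)) @ t^'+ --> (0 : R)} ->
  {ae P, forall w, cluster_set (fun t => (b t)^-1 *: Y t w) x} ->
  (\int[lebesgue_measure]_(t in (`]0%R, 1%R] : set R))
     ((t^-1)%:E * P (hit e0 t)) = +oo)%E.
Proof.
move=> e00 rc cl; set I := (\int[_]_(t in _) _)%E.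
apply/eqP/negPn/negP => Ioo.
have I0 : (0 <= I)%E.
  apply: integral_ge0 => t; rewrite /= in_itv/= => /andP[t0 _].
  by rewrite mule_ge0// lee_fin invr_ge0 ltW.
have Ifin : I \is a fin_num by rewrite ge0_fin_numE// ltey.
(* Scale [3 * e] for the rational visits plus [2 * e] for the passage to time [v] makes [e0]. *)
pose e := e0 / 5; have e_gt0 : 0 < e by rewrite divr_gt0.
have e3 : 0 <= e + 2 * e by rewrite addr_ge0 ?mulr_ge0 ?ltW.
have h1 : 0 < 2^-1 :> R by rewrite invr_gt0.
have h2 : 2^-1 < 1 :> R by rewrite invf_lt1 ?ltr1n.
have [th1 [s1 [th1_1 /andP[s10 s11] hs1]]] :=
  rational_hit_le e (e + 2 * e) 2^-1 e_gt0 e3 h1 h2.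
have [th2 [s2 [th2_1 /andP[s20 s21] hs2]]] := SS e 2^-1 e_gt0 h2.
pose th := Num.min th1 th2; pose s0 := Num.min s1 s2.
have th_1 : 1 < th by rewrite lt_min th1_1.
(* Two consecutive blocks span a ratio [lam ^+ 2 = th], the largest that the comparison allows. *)
pose lam := Num.sqrt th.
have lam2 : lam ^+ 2 = th by rewrite sqr_sqrtr// ltW// (lt_trans _ th_1).
have lam1 : 1 < lam by rewrite -sqrtr1 ltr_sqrt// (lt_trans _ th_1).
have lam0 : 0 < lam by exact: lt_trans lam1.
have lamth : lam <= th by rewrite -lam2 expr2 ler_pMl// ltW.
have s00 : 0 < s0 by rewrite lt_min s10.
have s01 : s0 <= 1 by rewrite ge_min s11.
pose H k := rational_hit (e + 2 * e) (s0 * lam ^- k.+2) (s0 * lam ^- k.+1).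
have mH k : measurable (H k).
  by apply: measurable_rational_hit => //; rewrite ltW// geom_gt0.
pose g k := 2^-1 * fine (P (H k)).
have g0 k : 0 <= g k by rewrite mulr_ge0 ?(ltW h1)// fine_ge0.
have gI n : ((\sum_(k < n) g k * (1 - lam^-1))%:E <= I)%E.
  apply: (geom_integral_ge s0 lam s00 s01 lam1 (fun v => P (hit e0 v))) => //.
  move=> k v /andP[kv vk].
  rewrite /g EFinM fineK ?fin_num_measure//.
  have -> : e0 = e + 2 * e + 2 * e by rewrite /e; field.
  apply: hs1; first exact: geom_gt0.
  - exact: lt_le_trans (geom_gt0 _ _ s00 lam1 _) kv.
  - by [].
  - rewrite (le_trans (ltW vk))// (le_trans _ (_ : th * (s0 * lam ^- k.+2) <= _))//.
      rewrite -lam2 le_eqVlt; apply/orP; left; apply/eqP; rewrite !exprS.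
      by field; rewrite !lt0r_neq0// exprn_gt0.
    by rewrite ler_pM2r ?geom_gt0// ge_min lexx.
  - rewrite (le_trans (ltW vk))//.
    have := geom_anti s0 lam s00 lam1 0 k (leq0n _); rewrite expr0 invr1 mulr1.
    by move=> /le_trans; apply; rewrite ge_min lexx.
have lamV : 0 < 1 - lam^-1 by rewrite subr_gt0 invf_lt1.
have PH : (\sum_(0 <= k <oo) P (H k) < +oo)%E.
  apply: (@le_lt_trans _ _ (2 * (fine I / (1 - lam^-1)))%:E); last by rewrite ltry.
  apply: lime_le; first by apply: is_cvg_nneseries => k _ _.
  apply: nearW => n; rewrite big_mkord.
  rewrite (eq_bigr (fun k : 'I_n => (fine (P (H k)))%:E)); last first.
    by move=> k _; rewrite fineK// fin_num_measure.
  rewrite sumEFin lee_fin -ler_pdivrMl// ler_pdivlMr//.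
  rewrite mulr_sumr mulr_suml -lee_fin fineK//.
  exact: gI.
have PL : P (lim_sup_set H) = 0%E by exact: lim_sup_set_cvg0.
have mL : measurable (lim_sup_set H).
  by apply: bigcapT_measurable => n; apply: bigcup_measurable => k _; exact: mH.
have aeL : {ae P, forall w, lim_sup_set H w}.
  apply: filterS2 rc cl => w rcw clw.
  apply: (cluster_rational_hit th2 s2) => //.
  - by rewrite ge_min lexx orbT.
  - by rewrite (le_trans lamth)// ge_min lexx orbT.
  - by move=> u v u0 uv vs vth; have [] := hs2 u v u0 uv vs vth.
(* The limsup event is both null and almost sure, so the whole space would be null. *)
have : P.-negligible (setT : set T).
  rewrite -(setvU (lim_sup_set H)); apply: negligibleU => //.
  exact/negligibleP.
move/(negligibleP P measurableT) => PT.
by have := probability_setT P; rewrite PT => /esym/eqP; rewrite onee_eq0.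
Qed.

(** If every avoidance event were null, almost every path would have, for each [n], a visit before
    time [1 / (n + 1)] at scale [1 / (n + 1)]; these visits form a sequence clustering at [x]. *)
Lemma positive_avoidance :
  ~ {ae P, forall w, cluster_set (fun t => (b t)^-1 *: Y t w) x} ->
  exists n : nat, 0 < fine (P (~` rational_hit n.+1%:R^-1 0 n.+1%:R^-1)).
Proof.
move=> ncl; apply: contrapT => noex; apply: ncl.
have neg n : {ae P, forall w, rational_hit n.+1%:R^-1 0 n.+1%:R^-1 w}.
  have mN : measurable (~` rational_hit n.+1%:R^-1 0 n.+1%:R^-1).
    by apply: measurableC; apply: measurable_rational_hit.
  apply/(negligibleP P mN); apply/eqP; rewrite eq_le measure_ge0 andbT.
  rewrite -(fineK (fin_num_measure P _ mN)) lee_fin leNgt; apply/negP => ?.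
  by apply: noex; exists n.
move/ae_foralln : neg; apply: filterS => w hw.
have /choice[u hu] : forall n, exists u : R, [/\ 0 < u, u < n.+1%:R^-1 &
    hit n.+1%:R^-1 u w].
  move=> n; have [m _] := hw n; rewrite -bigcup_seq => -[q /= qm hq].
  by have /andP[? ?] := rational_timesP _ _ _ _ qm; exists q.
exists u; split=> [n| |].
- by have [] := hu n.
- apply/cvgrPdist_lt => e e0; near=> n.
  have [u0 un _] := hu n; rewrite sub0r normrN gtr0_norm// (lt_trans un)//.
  by near: n; exact: near_infty_natSinv_lt (PosNum e0).
- apply/cvgrPdist_lt => e e0; near=> n.
  have [u0 un hn] := hu n; rewrite sub0r normrN ger0_norm ?eucl_norm_ge0//.
  have u1 : u n <= 1.
    by rewrite (le_trans (ltW un))// invf_le1// ler1n.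
  rewrite eucl_normalized_ltE ?bpos ?u0// (lt_trans hn)// ltr_pM2r ?bpos ?u0//.
  by near: n; exact: near_infty_natSinv_lt (PosNum e0).
Unshelve. all: by end_near.
Qed.

(** The increment from [v - t] to [v] has the law of [Y t] and is independent of the event that
    [Y (v - t)] is small and no time of [l] is a visit. The avoidance event [A] may depend on the
    whole path, so it enters only through a lower bound [p / 2] for the probability of that past
    event. *)
Lemma hit_le_first_hit (e e3 p : R) (t v : R) (A : set T) (l : seq R) :
  e3 = e + 2 * e -> 0 < e -> 0 < t -> t < v -> v <= 1 ->
  (b v - b t) * eucl_norm x <= e * b v ->
  ((1 - p / 2)%:E <= P [set w | (eucl_norm (Y (v - t) w) < e * b v)%R])%E ->
  measurable A -> p <= fine (P A) ->
  (forall r, r \in l -> 0 <= r <= v - t) ->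
  (forall r w, r \in l -> A w -> ~ hit e3 r w) ->
  fine (P (hit e t)) * (p / 2) <=
  fine (P (hit e3 v `\` \big[setU/set0]_(r <- l) hit e3 r)).
Proof.
move=> e3E e0 t0 tv v1 bx hG mA pA lv Al.
set U := \big[setU/set0]_(r <- l) _.
set s := v - t in hG lv *; have s0 : 0 < s by rewrite subr_gt0.
have v0 : 0 < v by exact: lt_trans tv.
have bv0 : 0 < b v by rewrite bpos// v0.
set G := [set w | _] in hG.
have GE : G = [set w | eucl_norm (Y s w - 0) < e * b v].
  by apply/seteqP; split => w /=; rewrite subr0.
have mG : measurable G by rewrite GE; apply: (measurable_ball P d Y LY); exact: ltW.
have mU : measurable U.
  rewrite /U big_seq; apply: bigsetU_measurable => r /lv/andP[r0 _].
  exact: measurable_hit.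
pose S := g_sigma_algebraType (past d Y (s :: l)).
have sU : <<s past d Y (s :: l) >> U.
  rewrite /U big_seq; apply: (@bigsetU_measurable _ S) => r rl.
  by apply: past_ball; rewrite inE rl orbT.
have sG : <<s past d Y (s :: l) >> G.
  by rewrite GE; apply: past_ball; exact: mem_head.
have sE : <<s past d Y (s :: l) >> (G `\` U) by exact: (@measurableD _ S).
have mE : measurable (G `\` U) by exact: measurableD.
have sv : s < v by rewrite /s ltrBlDr ltrDl.
have lsv r : r \in s :: l -> 0 <= r <= s.
  by rewrite inE => /predU1P[->|/lv//]; rewrite (ltW s0)/=.
have := indep_past_ball P d Y LY (s :: l) s v (b t *: x) (e * b t) (G `\` U)
  (ltW s0) sv lsv sE.
rewrite (_ : v - s = t); last by rewrite /s subKr.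
set F := [set w | _] => PEF.
have mF : measurable F by apply: (measurable_ball_incr P d Y LY); exact: ltW.
have mh : measurable (hit e t) by apply: measurable_hit => //; exact: ltW.
have mh3 : measurable (hit e3 v) by apply: measurable_hit => //; exact: ltW.
(* On [A] there is no visit in [l], and [p + (1 - p / 2) - 1 = p / 2]. *)
have h1 : p / 2 <= fine (P (G `\` U)).
  have AG : (P (A `&` G) <= P (G `\` U))%E.
    apply: le_measure; rewrite ?inE//; first exact: measurableI.
    move=> w [Aw Gw]; split => //; rewrite /U -bigcup_seq => -[r rl hr].
    exact: Al hr.
  have := probability_setI_ge P A G mA mG.
  have : 1 - p / 2 <= fine (P G) by rewrite -lee_fin fineK ?fin_num_measure.
  have : fine (P (A `&` G)) <= fine (P (G `\` U)).
    by rewrite fine_le ?fin_num_measure//; exact: measurableI.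
  by lra.
have h2 : fine (P ((G `\` U) `&` F)) <= fine (P (hit e3 v `\` U)).
  apply: fine_le; rewrite ?fin_num_measure//; first exact: measurableI.
    exact: measurableD.
  apply: le_measure; rewrite ?inE//; first exact: measurableI.
    exact: measurableD.
  move=> w [[Gw Uw] Fw]; split => //.
  have btv : b t <= b v by apply: bmono => //; exact: ltW.
  have := ball_transfer x _ _ _ _ e e (ltW e0) btv Fw (ltW Gw) bx.
  by rewrite subrK -e3E.
apply: le_trans h2; rewrite PEF fineM ?fin_num_measure// mulrC.
by rewrite ler_wpM2r// fine_ge0.
Qed.

(** Combines positive avoidance with the first-visit bound along a geometric sequence of rational
    times, then telescopes. Rationality matters because the avoidance event speaks of rational times
    only. *)
Lemma integral_lty_of_not_cluster :
  ~ {ae P, forall w, cluster_set (fun t => (b t)^-1 *: Y t w) x} ->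
  exists2 e : R, 0 < e &
  (\int[lebesgue_measure]_(t in (`]0%R, 1%R] : set R))
     ((t^-1)%:E * P (hit e t)) < +oo)%E.
Proof.
move=> /(positive_avoidance) [n].
set N := rational_hit _ _ _; set p := fine _ => p0.
pose a : R := n.+1%:R^-1; have a0 : 0 < a by rewrite invr_gt0.
have a1 : a <= 1 by rewrite invf_le1// ler1n.
(* The first-visit bound enlarges the scale from [e] to [3 * e], which must be the avoided scale
   [a]. *)
pose e := a / 3; have e0 : 0 < e by rewrite divr_gt0.
exists e => //.
have mN : measurable (~` N) by apply/measurableC/measurable_rational_hit.
have [th [s0 [th1 /andP[s00 s01] hs]]] := SS e (1 - p / 2) e0
  ltac:(by rewrite ltrBlDr ltrDl divr_gt0).
(* Taking [h] of the form [1 / (M + 1)] makes [lam = 1 + h] rational, and [h < 1] gives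
   [lam ^+ 2 <= 1 + 3 * h <= th]. *)
have [M hM] : exists M : nat, M.+1%:R^-1 < Num.min 1 ((th - 1) / 3) :> R.
  have z0 : 0 < Num.min 1 ((th - 1) / 3) by rewrite lt_min ltr01 divr_gt0// subr_gt0.
  have [M _ /(_ M (leqnn M)) hM] := near_infty_natSinv_lt (PosNum z0).
  by exists M.
pose h : R := M.+1%:R^-1; have h0 : 0 < h by rewrite invr_gt0.
have /andP[h1 h3] : (h < 1) && (h < (th - 1) / 3) by rewrite -lt_min.
pose lam := 1 + h; have lam1 : 1 < lam by rewrite ltrDl.
have lam0 : 0 < lam by exact: lt_trans lam1.
have lam2 : lam ^+ 2 <= th.
  have : h * h <= h by rewrite ler_piMl// ltW.
  by rewrite /lam expr2; lra.
(* The starting time is a power of [lam], hence rational, and lies below both the range of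
   [slowly_spread] and the avoidance horizon [a]. *)
have [k0] := geom_lt_eventually 1 lam ltr01 lam1 (Num.min s0 a) ltac:(by rewrite lt_min s00).
rewrite mul1r lt_min; set tau := lam ^- k0 => /andP[taus taua].
have tau0 : 0 < tau by rewrite invr_gt0 exprn_gt0.
have tau1 : tau <= 1 by rewrite (le_trans (ltW taua)).
pose t_ k := tau * lam ^- k.
have t0 k : 0 < t_ k by exact: geom_gt0.
have ttau k : t_ k <= tau.
  by have := geom_anti tau lam tau0 lam1 0 k (leq0n _); rewrite expr0 invr1 mulr1.
have t1 k : t_ k <= 1 by exact: le_trans tau1.
have trat k : exists q : rat, ratr q = t_ k.
  exists ((1 + (M.+1%:R)^-1)^-1 ^+ (k0 + k)).
  rewrite rmorphXn fmorphV rmorphD rmorph1 fmorphV rmorph_nat.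
  by rewrite /t_ /tau -/h -/lam exprD !exprVn.
(* With this [r], [t_ (k + r)] is at most [t_ k - t_ k.+1], so all later times of the sequence
   precede [t_ k - t] when [t < t_ k.+1]. *)
have [r] := geom_lt_eventually 1 lam ltr01 lam1 (1 - lam^-1)
  ltac:(by rewrite subr_gt0 invf_lt1).
rewrite mul1r => hr.
(* The horizon [J] keeps the list finite; the resulting bound does not depend on it. *)
pose l k J := [seq t_ j | j <- index_iota k J].
pose U k J := \big[setU/set0]_(s <- l k J) hit a s.
have mU k J : measurable (U k J).
  rewrite /U big_seq; apply: bigsetU_measurable => s /mapP[j _ ->].
  by apply: measurable_hit => //; exact: ltW.
pose A k J := fine (P (U k J)).
have A01 k J : 0 <= A k J <= 1.
  rewrite fine_ge0//= -lee_fin fineK ?fin_num_measure//.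
  exact: probability_le1.
(* The block of [t] is one step away from [v = t_ k]: this keeps [t_ k - t] bounded below while
   [t_ k <= lam ^+ 2 * t]. *)
have key k J t : (k < J)%N -> t_ k.+2 <= t < t_ k.+1 ->
    fine (P (hit e t)) * (p / 2) <= A k J - A (k + r)%N J.
  move=> kJ /andP[t2 tt1].
  have tt : 0 < t by exact: lt_le_trans t2.
  have t1k : t_ k.+1 < t_ k by rewrite /t_ [ltRHS]geomS// ltr_pMl// geom_gt0.
  have tv : t < t_ k by exact: lt_trans t1k.
  have tsmall : t_ (k + r)%N <= t_ k - t.
    have -> : t_ (k + r)%N = t_ k * lam ^- r by rewrite /t_ exprD invfM mulrA.
    apply: (@le_trans _ _ (t_ k * (1 - lam^-1))); first by rewrite ler_pM2l// ltW.
    have -> : t_ k * (1 - lam^-1) = t_ k - t_ k.+1.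
      by rewrite /t_ exprS invfM; ring.
    by rewrite lerD2l lerN2 ltW.
  have kth : t_ k <= th * t.
    rewrite (@le_trans _ _ (lam ^+ 2 * t_ k.+2))//.
      by rewrite /t_ [leLHS]geomS// [X in lam * X]geomS// mulrA -expr2.
    by apply: ler_pM => //; [exact: exprn_ge0 (ltW lam0)|exact: ltW].
  have [bx hG] := hs t (t_ k) tt tv (le_trans (ttau k) (ltW taus)) kth.
  have := hit_le_first_hit e a p t (t_ k) (~` N) (l (k + r)%N J).
  move=> /(_ _ e0 tt tv (t1 k) bx hG mN (lexx _) _ _)/le_trans; apply.
  - by rewrite /e; field.
  - move=> s /mapP[j]; rewrite mem_index_iota => /andP[kj _] ->.
    by rewrite (ltW (t0 j))/= (le_trans _ tsmall)// geom_anti.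
  - move=> s w /mapP[j _ ->] Nw hw; apply: Nw.
    have [q qE] := trat j; rewrite -qE in hw *.
    apply: (rational_hitP _ _ _ q) hw.
    by rewrite qE t0/= (le_lt_trans (ttau j)).
  have sub : hit a (t_ k) `\` U (k + r)%N J `<=` U k J `\` U (k + r)%N J.
    move=> w [hw nU]; split => //; rewrite /U -bigcup_seq; exists (t_ k) => //=.
    by apply/mapP; exists k => //; rewrite mem_index_iota leqnn.
  have subU : U (k + r)%N J `<=` U k J.
    move=> w; rewrite /U -!bigcup_seq => -[s /= /mapP[j jk ->] hw].
    exists (t_ j) => //=; apply/mapP; exists j => //.
    move: jk; rewrite !mem_index_iota => /andP[/(leq_trans (leq_addr _ _)) -> ->//].
  have mh : measurable (hit a (t_ k)).
    by apply: measurable_hit => //; exact: ltW.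
  have m1 : measurable (hit a (t_ k) `\` U (k + r)%N J) by exact: measurableD.
  have m2 : measurable (U k J `\` U (k + r)%N J) by exact: measurableD.
  apply: (@le_trans _ _ (fine (P (U k J `\` U (k + r)%N J)))).
    by rewrite fine_le ?fin_num_measure// le_measure ?inE.
  rewrite measureD ?ltey_eq ?fin_num_measure// setIidr// fineD ?fineN//.
    by rewrite fin_num_measure.
  by rewrite fin_numN fin_num_measure.
(* The supremum of [B k] is the single constant per block that [geom_integral_lty] asks for. *)
pose B k := [set fine (P (hit e t)) | t in [set t | t_ k.+2 <= t < t_ k.+1]].
have Bne k : B k !=set0.
  exists (fine (P (hit e (t_ k.+2)))); exists (t_ k.+2) => //=.
  by rewrite lexx/= /t_ [ltRHS]geomS// ltr_pMl// geom_gt0.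
have p20 : 0 < p / 2 by rewrite divr_gt0.
have Bub k J y : (k < J)%N -> B k y -> y <= (A k J - A (k + r)%N J) / (p / 2).
  by move=> kJ [t tk <-]; rewrite ler_pdivlMr//; exact: key.
have mhit t : 0 < t -> measurable (hit e t).
  by move=> tt; apply: measurable_hit => //; exact: ltW.
have Bsup k t : t_ k.+2 <= t < t_ k.+1 -> fine (P (hit e t)) <= sup (B k).
  move=> tk; apply: ub_le_sup; last by exists t.
  by exists ((A k k.+1 - A (k + r)%N k.+1) / (p / 2)) => y; exact: Bub.
pose tau' := t_ 1%N.
have tE k : tau' * lam ^- k = t_ k.+1 by rewrite /tau' /t_ expr1 exprS invfM mulrA.
apply: (geom_integral_lty tau' lam _ _ lam1 _ (fun k => sup (B k)) (r%:R / (p / 2))).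
- exact: t0.
- exact: t1.
- move=> v v0; rewrite measure_ge0/=; apply: probability_le1; exact: mhit.
- move=> k; have [y By] := Bne k; have [t tk yE] := By.
  by apply: le_trans (Bsup k t tk); rewrite fine_ge0.
- move=> k v; rewrite !tE => vk; rewrite -[leLHS]fineK ?lee_fin; first exact: Bsup.
  rewrite fin_num_measure//; apply: mhit.
  by have /andP[/(lt_le_trans (t0 _))] := vk.
move=> m; have [->|m0] := posnP m.
  by rewrite big_ord0 divr_ge0// ltW.
(* One common horizon [m] for all blocks of the partial sum makes the differences telescope. *)
apply: (@le_trans _ _ (\sum_(k < m) (A k m - A (k + r)%N m) / (p / 2))).
  apply: ler_sum => k _; apply: ge_sup => // y; exact: Bub.
rewrite -mulr_suml ler_pM2r ?invr_gt0//.
exact: (sum_shift_diff_le (fun k => A k m)).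
Qed.

End ClusterPoints.

(** * The equivalence, by reduction to the centered process *)

Theorem theorem5p2 (dT : measure_display) (T : measurableType dT)
    (R : realType) (P : probability T R) (d : nat)
    (X : R -> T -> 'rV[R]_d) (b : R -> R) (x : 'rV[R]_d) :
  levy_process P X ->
  (* b : [0,1] -> [0,1] continuous, increasing, b(1) = 1 *)
  {within `[0, 1], continuous b} ->
  (forall t, 0 <= t <= 1 -> 0 <= b t <= 1) ->
  (forall s t, 0 <= s -> s < t -> t <= 1 -> b s < b t) ->
  b 1 = 1 ->
  (* b(t)/t -> oo as t -> 0 *)
  (forall M : R, exists2 r : R, 0 < r & forall t, 0 < t < r -> M < b t / t) ->
  (* conditions (i), (ii) on some [0, t0] *)
  (exists2 t0 : R, 0 < t0 <= 1 &
     (exists2 rho : R, 1 / 3 < rho &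
        forall s t, 0 < s -> s <= t -> t <= t0 -> b s / s `^ rho <= b t / t `^ rho) /\
     (forall eps : R, 0 < eps -> exists2 de : R, 0 < de < t0 &
        forall s t, 0 <= s -> s <= t -> t <= de -> (1 - eps) * (s / t) <= b s / b t)) ->
  (* stochastic boundedness of X_t / b(t) *)
  (forall de : R, 0 < de -> exists K : R, exists td : R,
     [/\ 0 < K, 0 < td < 1 &
       forall t, 0 < t < td ->
         (P [set w | (K * b t < eucl_norm (X t w))%R] < de%:E)%E]) ->
  ({ae P, forall w, cluster_set (fun t => (b t)^-1 *: X t w) x} <->
   (forall eps : R, 0 < eps ->
      (\int[lebesgue_measure]_(t in `]0%R, 1%R] : set R)
         ((t^-1)%:E * P [set w | (eucl_norm ((b t)^-1 *: X t w - x) < eps)%R]))%E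
      = +oo%E)).
Proof.
move=> LX _ b01 binc _ _ [t0 t001 [[rho rho13 hi] hii]] hK.
pose Y t w := X t w - X 0 w.
have LY : centered_levy P d Y := centered_levy_of_levy P d X LX.
have [mX aeX _ stX _] := LX.
have bpos t : 0 < t <= 1 -> 0 < b t.
  move=> /andP[t_gt0 t1]; have /andP[b0 _] := b01 0 ltac:(by rewrite lexx ler01).
  by rewrite (le_lt_trans b0)// binc.
have bmono s t : 0 < s -> s <= t -> t <= 1 -> b s <= b t.
  move=> s0; rewrite le_eqVlt => /predU1P[-> //|st t1].
  by rewrite ltW// binc// ltW.
(* Stationarity on [[0, t]] identifies the one-dimensional laws of [Y] and [X], so boundedness and
   the integrals carry over. *)
have PYX t (B : set 'rV[R]_d) : 0 <= t -> borel_Rd B ->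
    P [set w | B (Y t w)] = P [set w | B (X t w)].
  by move=> t_ge0 bB; rewrite /Y (stX 0 t)// subr0.
have SS : slowly_spread P d Y b x.
  apply: (slowly_spread_of_bounded P d Y b x t0 rho) => //.
    by rewrite (lt_trans _ rho13)// divr_gt0.
  move=> de de0; have [K [td [K0 td01 h]]] := hK de de0; exists K, td; split => //.
  move=> t ttd; rewrite (PYX t [set z | K * b t < eucl_norm z]); first exact: h.
    by have /andP[/ltW] := ttd.
  exact: borel_Rd_norm_gt.
have IE (e : R) : (\int[lebesgue_measure]_(t in (`]0%R, 1%R] : set R))
      ((t^-1)%:E * P [set w | (eucl_norm ((b t)^-1 *: X t w - x) < e)%R]) =
    \int[lebesgue_measure]_(t in (`]0%R, 1%R] : set R))
      ((t^-1)%:E * P (hit d Y b x e t)))%E.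
  apply: eq_integral => t; rewrite inE /= in_itv/= => t01; congr (_ * _)%E.
  have /andP[t_gt0 _] := t01.
  rewrite (PYX t [set z | eucl_norm (z - b t *: x) < e * b t] (ltW t_gt0)); last first.
    exact: borel_Rd_ball.
  congr (P _); apply/seteqP; split => w /=;
    by rewrite -(eucl_normalized_ltE _ X _ x) ?bpos.
have aeYX : {ae P, forall w, cluster_set (fun t => (b t)^-1 *: X t w) x} <->
    {ae P, forall w, cluster_set (fun t => (b t)^-1 *: Y t w) x}.
  have ae0 : {ae P, forall w, X 0 w = 0} by apply: filterS aeX => w [].
  split => cl; apply: filterS2 ae0 cl => w X0; congr (cluster_set _ x);
    by apply/funext => t; rewrite /Y X0 subr0.
rewrite aeYX; split.
  move=> cl e e0; rewrite IE.
  apply: (cluster_integral_infinite P d Y b x) => //.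
  apply: filterS aeX => w [_ [rc _]] t t_ge0.
  rewrite (_ : (fun s => _) = (fun s => eucl_norm (X s w - X t w))); first exact: rc.
  by apply/funext => s; rewrite /Y opprB addrA subrK.
move=> Ioo; apply: contrapT => /(integral_lty_of_not_cluster P d Y b x LY bpos bmono SS).
by move=> [e e0]; rewrite -IE Ioo.
Qed.
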